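(* For each integer $k\ge 5$ and $n=k^2-3k+2$, we have $\mathrm{ex}_{\mathcal{P}}^*(n,C_4)=3n-6$.
   Context: All graphs are finite and simple. A proper edge-coloring of a graph assigns colors to edges so that adjacent edges (edges sharing an endpoint) get different colors. An edge-colored graph is rainbow if no two of its edges receive the same color. For a fixed graph $H$, the rainbow planar Turán number $\mathrm{ex}_{\mathcal{P}}^*(n,H)$ is the maximum number of edges in an $n$-vertex planar graph that admits a proper edge-coloring containing no rainbow copy of $H$ (as a subgraph). $C_4$ denotes the cycle on four vertices. *)

(* Defs.v *)
From HB Require Import structures.
From mathcomp Require Import all_boot all_order all_algebra.
From mathcomp Require Import all_classical all_reals all_analysis.
Import numFieldNormedType.Exports.

Set Implicit Arguments.
Unset Strict Implicit.
Unset Printing Implicit Defensive.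

Local Open Scope classical_set_scope.
Local Open Scope ring_scope.

(* A simple graph on the vertex set T is given by its set of edges, each edge
   being a set of two vertices. *)
Record sgraph (T : finType) := SGraph {
  edges :> {set {set T}};
  edges_card2 : [forall e in edges, #|e| == 2%N]
}.

HB.instance Definition _ (T : finType) := [isSub for @edges T].
HB.instance Definition _ (T : finType) := [Finite of sgraph T by <:].

(* Topological planarity: vertices are sent to distinct points of the plane, an
   edge to a simple arc joining (the images of) its two ends, and the interior
   of an arc meets neither a vertex nor the interior of another arc.  Only the
   restriction to [0, 1] of the curve (arc e) is relevant. *)
Definition planar (R : realType) (T : finType) (G : sgraph T) : Prop :=
  exists (pt : T -> R * R) (arc : {set T} -> R -> R * R),
  [/\ injective pt,
      forall e, e \in edges G ->
        {within `[0, 1], continuous (arc e)} /\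
        {in `[0, 1] &, injective (arc e)},
      forall e, e \in edges G ->
        exists x y : T,
          [/\ e = [set x; y]%SET, arc e 0 = pt x & arc e 1 = pt y],
      forall e (t : R) v, e \in edges G -> t \in `]0, 1[ -> arc e t <> pt v
    & forall e f (s t : R), e \in edges G -> f \in edges G -> e <> f ->
        s \in `]0, 1[ -> t \in `]0, 1[ -> arc e s <> arc f t].

(* Colors are natural numbers, and only the colors of edges of G matter. *)
Definition proper_edge_coloring (T : finType) (G : sgraph T)
    (c : {set T} -> nat) : Prop :=
  forall e f, e \in edges G -> f \in edges G -> e <> f ->
    (e :&: f <> finset.set0)%SET -> c e <> c f.

(* A copy of H in G is the image of H under an injective vertex map phi sending
   edges to edges; it need not be induced. *)
Definition rainbow_copy (U T : finType) (H : sgraph U) (G : sgraph T)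
    (c : {set T} -> nat) (phi : U -> T) : Prop :=
  [/\ injective phi,
      forall e, e \in edges H -> (phi @: e)%SET \in edges G
    & {in edges H &, injective (fun e : {set U} => c (phi @: e)%SET)}].

Definition rainbow_free_colorable (U T : finType) (H : sgraph U)
    (G : sgraph T) : Prop :=
  exists c : {set T} -> nat,
    proper_edge_coloring G c /\ ~ exists phi, rainbow_copy H G c phi.

(* The maximum over an empty family would be 0; if H has at least one edge, the
   edgeless graph always qualifies. *)
Definition rainbow_planar_turan (R : realType) (n : nat) (U : finType)
    (H : sgraph U) : nat :=
  \max_(G : sgraph 'I_n | `[< planar R G /\ rainbow_free_colorable H G >])
    #|edges G|.

Definition C4_edges : {set {set 'I_4}} :=
  [set [set i; ordS i] | i : 'I_4]%SET.

Lemma C4_edges_card2 : [forall e in C4_edges, #|e| == 2%N].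
Proof.
apply/forall_inP => e /imsetP[i _ ->]; rewrite cards2.
by case: i => [[|[|[|[|]]]] ?].
Qed.

Definition C4 : sgraph 'I_4 := SGraph C4_edges_card2.

(* Main.v *)
Require Import Defs.
From HB Require Import structures.
From mathcomp Require Import all_boot all_order all_algebra.
From mathcomp Require Import all_classical all_reals all_analysis.
From mathcomp Require Import zify ring lra.

Set Implicit Arguments.
Unset Strict Implicit.
Unset Printing Implicit Defensive.

(** Upper bound.  Call a graph lattice planar if its vertices are points of the
    integer lattice and its edges are joined through sets of lattice points so
    that disjoint edges use disjoint sets.  Rounding a topological drawing to a
    fine lattice shows that planar graphs are lattice planar, and, unlike
    topological planarity, this property is trivially stable under contraction.
    K5 is not lattice planar by a mod 2 winding number count, and a graph with
    more than 3n - 6 edges contracts to K5 (Mader), so no Jordan curve theorem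
    is needed.

    Lower bound.  With m = k - 3, stack m rings of length k, join consecutive
    rings as in an antiprism, and cap both ends by a pole; this triangulation
    has n = k m + 2 vertices.  The edge from position i to i + 1 of a ring gets
    colour i mod k; the edge from level l to l + 1 at position i gets colour
    i + l + 1 mod k; the diagonals between levels l and l + 1 get a private
    colour.  In each rhombus of two adjacent triangles one pair of opposite
    edges is then monochromatic, also at the second pole since it is at level
    m + 1 = -2 mod k, and these rhombi are the only 4-cycles. *)

(** * Lattice walks *)

Section LatticeWalks.
Local Open Scope ring_scope.
Implicit Types (p q v : int * int) (s : seq (int * int)).

Definition ladj p q : bool :=
  ((p.1 == q.1) && ((p.2 == q.2 + 1) || (q.2 == p.2 + 1))) ||
  ((p.2 == q.2) && ((p.1 == q.1 + 1) || (q.1 == p.1 + 1))).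

Lemma ladj_sym p q : ladj p q = ladj q p.
Proof. rewrite /ladj; lia. Qed.

Fixpoint walk_count (f : int * int -> int * int -> bool) p s : nat :=
  if s is q :: s' then (f p q + walk_count f q s')%N else 0%N.

(** A step counts when it crosses the upward ray from [v], displaced half a unit to the left so that
    it avoids lattice points. In [below] the ray points downward and is displaced to the right. *)
Definition above (v p q : int * int) : bool :=
  ((p.1 < v.1) (+) (q.1 < v.1)) && (v.2 < p.2).

Definition below (v p q : int * int) : bool :=
  ((p.1 <= v.1) (+) (q.1 <= v.1)) && (p.2 < v.2).

(** The two displaced rays of [v] form a broken line that cuts the lattice in two; this is the left
    half, containing [v] itself. *)
Definition lex_before p v : bool :=
  (p.1 < v.1) || ((p.1 == v.1) && (p.2 <= v.2)).

Lemma lex_before_asym p q : p != q -> (lex_before p q + lex_before q p)%N = 1%N.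
Proof.
by case: p q => [a b] [c d]; rewrite /lex_before xpair_eqE /=; lia.
Qed.

Lemma ladjP p q : ladj p q ->
  exists x y, (p = (x, y) /\ (q = (x, y + 1) \/ q = (x + 1, y))) \/
              (q = (x, y) /\ (p = (x, y + 1) \/ p = (x + 1, y))).
Proof.
case: p q => [a b] [c d]; rewrite /ladj /=.
case/orP=> /andP[/eqP-> /orP[]/eqP->].
- by exists c, d; right; split=> //; left.
- by exists c, b; left; split=> //; left.
- by exists c, d; right; split=> //; right.
- by exists a, d; left; split=> //; right.
Qed.

Lemma le_addb_step (c a : int) : (c <= a) (+) (c + 1 <= a) = (c == a).
Proof. lia. Qed.

Lemma lt_addb_step (c a : int) : (c < a) (+) (c + 1 < a) = (c + 1 == a).
Proof. lia. Qed.

Lemma aboveC v p q : ladj p q -> above v p q = above v q p.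
Proof.
by case/ladjP=> x [y [][-> []->]]; rewrite /above /= ?addbb // addbC.
Qed.

Lemma belowC v p q : ladj p q -> below v p q = below v q p.
Proof.
by case/ladjP=> x [y [][-> []->]]; rewrite /below /= ?addbb // addbC.
Qed.

(** The step from [p] to [p'] and the downward rays of its ends bound a region, empty for a vertical
    step, and [above q p p'] says that [q] lies in it. Since the two steps share no point, the other
    step enters or leaves this region only across one of the rays. *)
Lemma step_exchange p p' q q' : ladj p p' -> ladj q q' ->
  q != p -> q != p' -> q' != p -> q' != p' ->
  odd (below p q q' + below p' q q' + above q p p' + above q' p p')%N = false.
Proof.
wlog: p p' / exists x y, p = (x, y) /\ (p' = (x, y + 1) \/ p' = (x + 1, y)).
  move=> H pp' qq' n1 n2 n3 n4; have [x [y [] E]] := ladjP pp'.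
    by apply: H => //; exists x, y.
  rewrite (aboveC q pp') (aboveC q' pp') (addnC (below p q q')).
  by apply: H => //; [exists x, y | rewrite ladj_sym].
wlog: q q' / exists x y, q = (x, y) /\ (q' = (x, y + 1) \/ q' = (x + 1, y)).
  move=> H Ep pp' qq' n1 n2 n3 n4; have [x [y [] E]] := ladjP qq'.
    by apply: H => //; exists x, y.
  rewrite (belowC p qq') (belowC p' qq') -addnA (addnC (above q p p')) addnA.
  by apply: H => //; [exists x, y | rewrite ladj_sym].
move=> [x [y [-> Eq]]] [z [t [-> Ep]]] _ _.
case: Eq Ep => -> [] ->; rewrite /below /above /= ?le_addb_step ?lt_addb_step ?addbb //.
- by rewrite !xpair_eqE; lia.
- by rewrite !xpair_eqE; lia.
- by rewrite !xpair_eqE; lia.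
Qed.

(** A step avoiding [v] changes sides of the broken line exactly when it crosses one of the two
    rays. *)
Lemma step_total v q q' : ladj q q' -> q != v -> q' != v ->
  odd (above v q q' + below v q q' + lex_before q v + lex_before q' v)%N = false.
Proof.
wlog: q q' / exists x y, q = (x, y) /\ (q' = (x, y + 1) \/ q' = (x + 1, y)).
  move=> H qq' n1 n2; have [x [y [] E]] := ladjP qq'.
    by apply: H => //; exists x, y.
  rewrite (belowC v qq') (aboveC v qq') -addnA (addnC (lex_before q v)) addnA.
  by apply: H => //; [exists x, y | rewrite ladj_sym].
case: v => a b [x [y [-> []->]]] _.
  by rewrite /above /below /lex_before !addbb !xpair_eqE /=; lia.
by rewrite /above /below /lex_before le_addb_step lt_addb_step !xpair_eqE /=; lia.
Qed.

(** Telescoping modulo 2: the term [y] of the middle point occurs twice and cancels. *)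
Lemma odd_glue (a b c d x y z : nat) :
  odd (c + d + y + z) = false -> odd (a + b + x + y) = false ->
  odd ((a + c) + (b + d) + x + z) = false.
Proof. lia. Qed.

Lemma walk_total v p s : path ladj p s -> v \notin p :: s ->
  odd (walk_count (above v) p s + walk_count (below v) p s +
       lex_before p v + lex_before (last p s) v)%N = false.
Proof.
elim: s p => [|q s IH] p /=; first by move=> _ _; lia.
case/andP=> pq qs; rewrite !inE !negb_or => /and3P[vp vq vs].
have := IH q qs; rewrite inE negb_or vq vs => /(_ isT).
have := @step_total v p q pq.
rewrite (eq_sym p) (eq_sym q) vp vq => /(_ isT isT) st tot.
exact: odd_glue tot st.
Qed.

Lemma step_walk_exchange p p' q s : ladj p p' -> path ladj q s ->
  p \notin q :: s -> p' \notin q :: s ->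
  odd (walk_count (below p) q s + walk_count (below p') q s +
       above q p p' + above (last q s) p p')%N = false.
Proof.
move=> pp'; elim: s q => [|q' s IH] q /=; first by move=> _ _ _; lia.
case/andP=> qq' q's; rewrite !inE !negb_or => /and3P[pq pq' ps] /and3P[p'q p'q' p's].
have := IH q' q's; rewrite !inE !negb_or pq' ps p'q' p's => /(_ isT isT).
have := step_exchange pp' qq'.
rewrite !(eq_sym q) !(eq_sym q') pq pq' p'q p'q' => /(_ isT isT isT isT) st IHq'.
exact: odd_glue IHq' st.
Qed.

(** Summed over the steps of both walks, [step_exchange] telescopes in the inner points and leaves
    only the four ends. *)
Lemma walk_exchange p s q s' : path ladj p s -> path ladj q s' ->
  {in p :: s, forall x, x \notin q :: s'} ->
  odd (walk_count (below p) q s' + walk_count (below (last p s)) q s' +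
       walk_count (above q) p s + walk_count (above (last q s')) p s)%N = false.
Proof.
move=> + qs'; elim: s p => [|p' s IH] p /=; first by move=> _ _; lia.
case/andP=> pp' p's dis.
have {}dis' : {in p' :: s, forall x, x \notin q :: s'}.
  by move=> x xs; apply: dis; rewrite inE xs orbT.
have := IH p' p's dis'.
have := step_walk_exchange pp' qs' (dis _ (mem_head _ _)) (dis' _ (mem_head _ _)).
set b1 := walk_count _ q s'; set b2 := walk_count _ q s'.
set b3 := walk_count _ q s'; set a1 := nat_of_bool _; set a2 := nat_of_bool _.
move: b1 b2 b3 a1 a2 (walk_count _ p' s) (walk_count _ p' s); lia.
Qed.

(** * Connection by lattice walks inside a set of points *)

Definition joined (S : int * int -> Prop) p q : Prop :=
  exists s, [/\ path ladj p s, last p s = q & {in p :: s, forall x, S x}].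

Lemma joined_refl (S : int * int -> Prop) p : S p -> joined S p p.
Proof. by move=> Sp; exists [::]; split=> // x; rewrite inE => /eqP->. Qed.

Lemma joined_step (S : int * int -> Prop) p q :
  ladj p q -> S p -> S q -> joined S p q.
Proof.
move=> pq Sp Sq; exists [:: q]; split; rewrite /= ?pq // => x.
by rewrite !inE => /orP[]/eqP->.
Qed.

Lemma joined_trans (S : int * int -> Prop) p q r :
  joined S p q -> joined S q r -> joined S p r.
Proof.
move=> [s [ps sq sS]] [s' [qs' s'r s'S]]; exists (s ++ s'); split.
- by rewrite cat_path ps sq.
- by rewrite last_cat sq.
- move=> x; rewrite -cat_cons mem_cat => /orP[/sS //|xs'].
  by apply: s'S; rewrite inE xs' orbT.
Qed.

Lemma joined_sub (S S' : int * int -> Prop) p q :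
  (forall x, S x -> S' x) -> joined S p q -> joined S' p q.
Proof. by move=> sub [s [ps sq sS]]; exists s; split=> // x /sS/sub. Qed.

Lemma joined_sym (S : int * int -> Prop) p q : joined S p q -> joined S q p.
Proof.
move=> [s [+ + +]]; elim: s p => [|p' s IH] p /=.
  by move=> _ <- Sp; apply/joined_refl/Sp; rewrite inE.
case/andP=> pp' p's sq sS; apply: (@joined_trans _ _ p').
  by apply: IH => // x xs; apply: sS; rewrite inE xs orbT.
by apply: joined_step; rewrite 1?ladj_sym //; apply: sS; rewrite !inE eqxx ?orbT.
Qed.

(* Mod 2, the walk ij winds around k and l as often as kl winds around i and j,
   up to the order of the four points, so in every K4 an odd number of vertices
   is inside the opposite triangle, while every triangle has its two other
   vertices on the same side; summing over the five K4's is contradictory. *)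
Lemma no_lattice_K5 (P : nat -> int * int) (S : nat -> nat -> int * int -> Prop) :
  (forall i j, (i < j < 5)%N -> joined (S i j) (P i) (P j)) ->
  (forall i j k l x, (i < j < 5)%N -> (k < l < 5)%N -> uniq [:: i; j; k; l] ->
     S i j x -> S k l x -> False) -> False.
Proof.
move=> SP dS.
have [w wP] : exists w : nat -> nat -> seq (int * int), forall i j, (i < j < 5)%N ->
    [/\ path ladj (P i) (w i j), last (P i) (w i j) = P j &
        {in P i :: w i j, forall x, S i j x}].
  have /choice[w wP] : forall ij : nat * nat, exists s, (ij.1 < ij.2 < 5)%N ->
      [/\ path ladj (P ij.1) s, last (P ij.1) s = P ij.2 &
        {in P ij.1 :: s, forall x, S ij.1 ij.2 x}].
    move=> [i j] /=; case: (boolP (i < j < 5)%N) => [ij|_]; last by exists [::].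
    by have [s ?] := SP i j ij; exists s.
  by exists (fun i j => w (i, j)) => i j; exact: (wP (i, j)).
pose X i j k := walk_count (above (P k)) (P i) (w i j).
pose Y i j k := walk_count (below (P k)) (P i) (w i j).
pose r i j := nat_of_bool (lex_before (P i) (P j)).
have notin i j k l : (i < j < 5)%N -> (k < l < 5)%N -> uniq [:: i; j; k; l] ->
    {in P i :: w i j, forall x, x \notin P k :: w k l}.
  move=> ij kl u x xij; apply/negP => xkl.
  have [_ _ Sij] := wP _ _ ij; have [_ _ Skl] := wP _ _ kl.
  exact: (dS _ _ _ _ x ij kl u (Sij _ xij) (Skl _ xkl)).
have exch i j k l : (i < j < 5)%N -> (k < l < 5)%N -> uniq [:: i; j; k; l] ->
    odd (Y k l i + Y k l j + X i j k + X i j l) = false.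
  move=> ij kl u; have [pij lij _] := wP _ _ ij; have [pkl lkl _] := wP _ _ kl.
  by have := walk_exchange pij pkl (notin _ _ _ _ ij kl u); rewrite lij lkl.
have mem1 i j : (i < j < 5)%N -> (P i \in P i :: w i j) /\ (P j \in P i :: w i j).
  by move=> ij; have [_ <- _] := wP _ _ ij; rewrite mem_last inE eqxx.
have tot i j k l : (i < j < 5)%N -> (k < l < 5)%N -> uniq [:: i; j; k; l] ->
    odd (X i j k + Y i j k + r i k + r j k) = false /\
    odd (X i j l + Y i j l + r i l + r j l) = false.
  move=> ij kl u; have [pij lij _] := wP _ _ ij.
  have nij := notin _ _ _ _ ij kl u; have [mk ml] := mem1 _ _ kl.
  split.
    by have := @walk_total (P k) _ _ pij; rewrite lij; apply; apply: contraTN mk; apply: nij.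
  by have := @walk_total (P l) _ _ pij; rewrite lij; apply; apply: contraTN ml; apply: nij.
have asym i j k l : (i < j < 5)%N -> (k < l < 5)%N -> uniq [:: i; j; k; l] ->
    [/\ (r i k + r k i = 1)%N, (r i l + r l i = 1)%N,
        (r j k + r k j = 1)%N & (r j l + r l j = 1)%N].
  move=> ij kl u; have nij := notin _ _ _ _ ij kl u.
  have [mi mj] := mem1 _ _ ij; have [mk ml] := mem1 _ _ kl.
  by split; apply: lex_before_asym; apply/eqP => E;
    [move: (nij _ mi)|move: (nij _ mi)|move: (nij _ mj)|move: (nij _ mj)];
    rewrite E ?mk ?ml.
(* The downward crossings [Y] in [exch] are traded for upward ones by [tot], at the price of the
   order terms [r]. *)
have matching i j k l : (i < j < 5)%N -> (k < l < 5)%N -> uniq [:: i; j; k; l] ->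
    odd (X i j k + X i j l + X k l i + X k l j + r k i + r l i + r k j + r l j) = false.
  move=> ij kl u; have u' : uniq [:: k; l; i; j].
    by move: u; rewrite -(rot_uniq 2).
  have := exch _ _ _ _ ij kl u; have [] := tot _ _ _ _ kl ij u'; clear; lia.
(* Add the relations of the three perfect matchings. Order terms involving [i] occur twice and
   cancel; each of the pairs [j k], [j l], [k l] occurs once in either order and contributes 1, in
   total 3. *)
have K4 i j k l : (i < j)%N -> (j < k)%N -> (k < l < 5)%N ->
    odd (X i j k + X i j l + X k l i + X k l j + X i k j + X i k l +
         X j l i + X j l k + X i l j + X i l k + X j k i + X j k l) = true.
  move=> ij jk /andP[kl l5].
  have u : uniq [:: i; j; k; l] by rewrite /= !inE; lia.
  have u' : uniq [:: i; k; j; l] by rewrite /= !inE; lia.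
  have u'' : uniq [:: i; l; j; k] by rewrite /= !inE; lia.
  have hij : (i < j < 5)%N by lia.
  have hik : (i < k < 5)%N by lia.
  have hil : (i < l < 5)%N by lia.
  have hjk : (j < k < 5)%N by lia.
  have hjl : (j < l < 5)%N by lia.
  have hkl : (k < l < 5)%N by lia.
  have := matching _ _ _ _ hij hkl u.
  have := matching _ _ _ _ hik hjl u'.
  have := matching _ _ _ _ hil hjk u''.
  have [] := asym _ _ _ _ hij hkl u.
  have [] := asym _ _ _ _ hik hjl u'.
  have [] := asym _ _ _ _ hil hjk u''.
  clear; lia.
(* Add [exch] over the sides of the triangle: each of its vertices lies on two sides, so the terms
   [Y l m] cancel. *)
have tri i j k l m : (i < j)%N -> (j < k < 5)%N -> (l < m < 5)%N ->
    uniq [:: i; j; k; l; m] ->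
    odd (X i j l + X i j m + X i k l + X i k m + X j k l + X j k m) = false.
  move=> ij jk lm; rewrite /= !inE => u.
  have hij : (i < j < 5)%N by lia.
  have hik : (i < k < 5)%N by lia.
  have u1 : uniq [:: i; j; l; m] by rewrite /= !inE; lia.
  have u2 : uniq [:: i; k; l; m] by rewrite /= !inE; lia.
  have u3 : uniq [:: j; k; l; m] by rewrite /= !inE; lia.
  have := exch _ _ _ _ hij lm u1; have := exch _ _ _ _ hik lm u2.
  by have := exch _ _ _ _ jk lm u3; clear; lia.
have := K4 0 1 2 3 isT isT isT; have := K4 0 1 2 4 isT isT isT.
have := K4 0 1 3 4 isT isT isT; have := K4 0 2 3 4 isT isT isT.
have := K4 1 2 3 4 isT isT isT.
have := tri 0 1 2 3 4 isT isT isT isT; have := tri 0 1 3 2 4 isT isT isT isT.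
have := tri 0 1 4 2 3 isT isT isT isT; have := tri 0 2 3 1 4 isT isT isT isT.
have := tri 0 2 4 1 3 isT isT isT isT; have := tri 0 3 4 1 2 isT isT isT isT.
have := tri 1 2 3 0 4 isT isT isT isT; have := tri 1 2 4 0 3 isT isT isT isT.
have := tri 1 3 4 0 2 isT isT isT isT; have := tri 2 3 4 0 1 isT isT isT isT.
clear; lia.
Qed.

End LatticeWalks.

(** * Lattice planar graphs have at most 3n - 6 edges *)

Section LatticePlanar.
Variable T : finType.
Implicit Types (e : rel T) (V : {set T}) (x y z u v w : T).

(* A weak form of planarity: only the curves of disjoint edges have to avoid
   each other, which makes it stable under edge contraction. *)
Definition lattice_planar e : Prop :=
  exists (P : T -> int * int) (S : T -> T -> int * int -> Prop),
    (forall x y, e x y -> joined (S x y) (P x) (P y)) /\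
    (forall x y z t p, e x y -> e z t -> [&& x != z, x != t, y != z & y != t] ->
       S x y p -> S z t p -> False).

Lemma lattice_planar_sub e e' : subrel e' e -> lattice_planar e -> lattice_planar e'.
Proof.
move=> sub [P [S [SP dS]]]; exists P, S; split=> [x y /sub/SP //|].
by move=> x y z t p /sub xy /sub zt; apply: dS.
Qed.

Lemma lattice_planar_K5_free e (s : seq T) : lattice_planar e ->
  size s = 5 -> uniq s -> pairwise e s -> False.
Proof.
move=> [P [S [SP dS]]] s5 us /= ps.
have x0 : T by case: s s5 {us ps}.
have adj i j : i < j < 5 -> e (nth x0 s i) (nth x0 s j).
  by move=> ij; apply: (pairwiseP x0 ps); rewrite ?inE ?s5; lia.
apply: (@no_lattice_K5 (fun i => P (nth x0 s i))
          (fun i j => S (nth x0 s i) (nth x0 s j))) => [i j ij|].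
  exact/SP/adj.
move=> i j k l p ij kl u; apply: dS; [exact: adj|exact: adj|].
by move: u; rewrite !nth_uniq ?s5 //= ?inE; lia.
Qed.

(** The vertex [v] is merged into [u] but stays in [T] as an isolated point, so that the vertex type
    does not change. *)
Definition contract u v e : rel T := [rel x y |
  [&& x != v, y != v, x != y & [|| e x y, (x == u) && e v y | (y == u) && e x v]]].

Lemma contractE u v e x y : contract u v e x y =
  [&& x != v, y != v, x != y & [|| e x y, (x == u) && e v y | (y == u) && e x v]].
Proof. by []. Qed.

Lemma contract_sym u v e : symmetric e -> symmetric (contract u v e).
Proof.
move=> se x y; rewrite !contractE (eq_sym y x) (se y x) (se v x) (se y v).
by rewrite [X in e x y || X]orbC; case: (x != v); case: (y != v).
Qed.

(** A new edge at [u] is routed through [v], along the old curve of [u v] and a curve at [v]. Only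
    edges ending at [u] are rerouted, and of two disjoint edges at most one ends there. *)
Lemma lattice_planar_contract u v e : symmetric e -> e u v ->
  lattice_planar e -> lattice_planar (contract u v e).
Proof.
move=> se uv [P [S [SP dS]]].
pose S' x y p := if e x y then S x y p
  else if x == u then S u v p \/ S v y p else S x v p \/ S v u p.
(* Each point of a new curve lies on an old one with ends among [x] and [y], or also [v] if one of
   these is [u]. *)
have S'P x y p : contract u v e x y -> S' x y p -> exists a b,
    [/\ e a b, S a b p, [|| a == x, a == y | (a == v) && ((x == u) || (y == u))]
      & [|| b == x, b == y | (b == v) && ((x == u) || (y == u))]].
  rewrite contractE /S' => /and4P[_ _ _]; case: ifP => [exy _|_ /=].
    by move=> Sp; exists x, y; rewrite !eqxx !orbT.
  case: ifP => [/eqP-> /= h [] Sp|_ /= /andP[/eqP-> xv] [] Sp].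
  - by exists u, v; rewrite !eqxx !orbT.
  - exists v, y; rewrite !eqxx !orbT; split=> //.
    case/orP: h => // /andP[/eqP-> _]; by rewrite se.
  - by exists x, v; rewrite !eqxx !orbT.
  - by exists v, u; rewrite !eqxx !orbT; split=> //; rewrite se.
exists P, S'; split.
  move=> x y; rewrite contractE => /and4P[xv yv _].
  rewrite /S'; have [exy _|_ /=] := boolP (e x y); first exact: SP.
  case: (eqVneq x u) => [-> /= h|_ /= /andP[/eqP-> exv]].
    have evy : e v y by case/orP: h => // /andP[/eqP-> _]; rewrite se.
    apply: (@joined_trans _ _ (P v)).
      by apply: joined_sub (SP _ _ uv) => p; left.
    by apply: joined_sub (SP _ _ evy) => p; right.
  apply: (@joined_trans _ _ (P v)).
    by apply: joined_sub (SP _ _ exv) => p; left.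
  by rewrite se in uv; apply: joined_sub (SP _ _ uv) => p; right.
move=> x y z t p exy ezt dis /(S'P _ _ _ exy)[a [b [eab Sab ha hb]]].
move=> /(S'P _ _ _ ezt)[c [d [ecd Scd hc hd]]].
have key a' c' : [|| a' == x, a' == y | (a' == v) && ((x == u) || (y == u))] ->
    [|| c' == z, c' == t | (c' == v) && ((z == u) || (t == u))] -> a' != c'.
  move: exy ezt dis; rewrite !contractE => /and4P[xv yv _ _] /and4P[zv tv _ _] /and4P[xz xt yz yt].
  case/or3P=> [/eqP->|/eqP->|/andP[/eqP-> u1]];
    case/or3P=> [/eqP->|/eqP->|/andP[/eqP-> u2]] //; rewrite 1?eq_sym //.
  by case/orP: u1 u2 xz xt yz yt => /eqP-> /orP[]/eqP->; rewrite eqxx.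
by apply: dS eab ecd _ Sab Scd; rewrite !key.
Qed.

(** * Counting edges as ordered pairs of adjacent vertices *)

Definition arcs e : {set T * T} := [set xy | e xy.1 xy.2].

(** Renaming [v] to [u] loses the edge [u v] and one of the two edges to each common neighbour;
    every edge counts twice. The map [f] is this renaming, injective outside the lost arcs [bad]. *)
Lemma card_arcs_contract u v e : symmetric e -> irreflexive e -> e u v ->
  #|arcs e| <= #|arcs (contract u v e)| + 2 + 2 * #|[set w | e u w && e v w]|.
Proof.
move=> se ie uv; set C := [set w | _].
pose bad := [set (u, v); (v, u)]%SET :|: ((pair v) @: C :|: (fun w => (w, v)) @: C).
pose g x := if x == v then u else x.
pose f (xy : T * T) := (g xy.1, g xy.2).
have uv' : u != v by apply: contraTneq uv => ->; rewrite ie.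
have badC : #|bad| <= 2 + 2 * #|C|.
  apply: leq_trans (leq_card_setU _ _) _; rewrite cards2 leq_add //.
    by case: eqP.
  apply: leq_trans (leq_card_setU _ _) _.
  by rewrite mul2n -addnn leq_add // leq_imset_card.
have badP x y : e x y -> (x, y) \notin bad ->
    [/\ x = v -> y != u, y = v -> x != u, x = v -> ~~ e u y & y = v -> ~~ e u x].
  move=> exy; rewrite !inE !negb_or !xpair_eqE => /andP[/andP[b1 b2] /andP[b3 b4]]; split.
  - by move=> xv; move: b2; rewrite xv eqxx.
  - by move=> yv; move: b1; rewrite yv eqxx andbT.
  - move=> xv; apply: contra b3 => uy; apply/imsetP; exists y; last by rewrite xv.
    by rewrite inE uy -xv.
  - move=> yv; apply: contra b4 => ux; apply/imsetP; exists x; last by rewrite yv.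
    by rewrite inE ux -yv se.
have gn x : g x != v by rewrite /g; case: (eqVneq x v).
suff : #|arcs e :\: bad| <= #|arcs (contract u v e)|.
  move=> h; rewrite -(cardsID bad (arcs e)) addnC -addnA leq_add //.
  exact: leq_trans (subset_leq_card (subsetIr _ _)) badC.
rewrite -(card_in_imset (f := f)).
  apply/subset_leq_card/fintype.subsetP => _ /imsetP[[x y] + ->].
  rewrite finset.in_setD => /andP[nb]; rewrite inE /= => exy.
  have [h1 h2 h3 h4] := badP x y exy nb; rewrite inE contractE !gn /=.
  move: h1 h2 h3 h4; rewrite /g.
  case: (eqVneq x v) exy => [-> | xv] exy; case: (eqVneq y v) exy => [-> | yv] exy.
  - by rewrite ie in exy.
  - by move=> /(_ erefl) yu _ _ _; rewrite eq_sym yu exy eqxx !orbT.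
  - by move=> _ /(_ erefl) xu _ _; rewrite xu exy eqxx !orbT.
  - by move=> _ _ _ _; rewrite exy /= andbT; apply: contraTneq exy => ->; rewrite ie.
move=> [x y] [x' y']; rewrite !finset.in_setD => /andP[nb]; rewrite inE /= => exy.
move=> /andP[nb']; rewrite inE /= => exy'.
have [h1 h2 h3 h4] := badP x y exy nb; have [h1' h2' h3' h4'] := badP x' y' exy' nb'.
rewrite /f /g /= => -[].
have nvv z : e z z -> False by rewrite ie.
case: (eqVneq x v) => xv; case: (eqVneq x' v) => xv'; case: (eqVneq y v) => yv;
  case: (eqVneq y' v) => yv' Ex Ey; subst => //.
all: try by have := nvv _ exy.
all: try by have := nvv _ exy'.
all: try by have := h3 erefl; rewrite ?exy' ?exy.
all: try by have := h3' erefl; rewrite ?exy' ?exy.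
all: try by have := h4 erefl; rewrite 1?se ?exy' ?exy.
all: try by have := h4' erefl; rewrite 1?se ?exy' ?exy.
all: try by have := h2 erefl; rewrite eqxx.
all: try by have := h2' erefl; rewrite eqxx.
Qed.

Lemma card_arcs e : #|arcs e| = \sum_x #|[set y | e x y]|.
Proof.
rewrite -sum1_card (eq_bigl (fun xy : T * T => e xy.1 xy.2)); last first.
  by move=> xy; rewrite inE.
rewrite -(pair_big_dep xpredT e (fun _ _ => 1)) /=; apply: eq_bigr => x _.
by rewrite -sum1_card; apply: eq_bigl => y; rewrite inE.
Qed.

(** Averaging: if all degrees in [V] were at least 6, they would add up to too many arcs. *)
Lemma small_degree e V : (forall x y, e x y -> x \in V) ->
  #|arcs e| < 6 * #|V| -> exists2 x, x \in V & #|[set y | e x y]| <= 5.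
Proof.
move=> eV lt; apply/exists_inP; apply: contraLR lt => /exists_inPn big.
rewrite -leqNgt card_arcs (bigID (mem V)) /= mulnC -sum_nat_const.
apply: leq_trans (leq_addr _ _); apply: leq_sum => x xV.
by have := big x xV; rewrite -ltnNge.
Qed.

Lemma card_arcs_le e V : irreflexive e -> (forall x y, e x y -> x \in V) ->
  symmetric e -> #|arcs e| <= #|V| * (#|V|).-1.
Proof.
move=> ie eV se; rewrite card_arcs (bigID (mem V)) /= [X in _ + X]big1 ?addn0.
  rewrite -sum_nat_const; apply: leq_sum => x xV.
  rewrite (cardsD1 x V) xV /=; apply/subset_leq_card/fintype.subsetP => y.
  rewrite !inE => exy; rewrite (eV y x) 1?se // andbT.
  by apply: contraTneq exy => ->; rewrite ie.
move=> x xV; apply: eq_card0 => y; rewrite !inE.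
by apply: contraNF xV => /eV.
Qed.


Lemma in_common_nbrs e x y w : (w \in [set w | e x w && e y w]) = e x w && e y w.
Proof. by rewrite inE. Qed.

(* In a minor-minimal graph with 3n - 5 edges every edge lies in three triangles,
   so a vertex of degree at most 5 sees a K4, or a K5 minus a matching. *)
Lemma dense_neighborhood_K5 e x : symmetric e -> irreflexive e -> lattice_planar e ->
  0 < #|[set y | e x y]| <= 5 ->
  (forall y, e x y -> 3 <= #|[set w | e x w && e y w]|) -> False.
Proof.
move=> se ie pe; set N := [set y | e x y] => /andP[N0 N5] tri.
have NP y : (y \in N) = e x y by rewrite inE.
have nx y : e x y -> y != x by apply: contraTneq => ->; rewrite ie.
have sub y : e x y -> [set w | e x w && e y w] \subset N :\ y.
  move=> xy; apply/fintype.subsetP => w; rewrite in_common_nbrs !inE => /andP[-> yw].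
  by rewrite andbT; apply: contraTneq yw => ->; rewrite ie.
have cN y : e x y -> #|N :\ y| = #|N|.-1 by move=> xy; rewrite (cardsD1 y N) NP xy.
have N4 : 4 <= #|N|.
  have /card_gt0P[y] := N0; rewrite NP => xy.
  have := leq_trans (tri y xy) (subset_leq_card (sub y xy)); rewrite cN //; lia.
(* A neighbour [y] of [x] is adjacent to at least three of the at most four other neighbours of [x],
   so it misses at most one of them. *)
have adj y z z' : e x y -> e x z -> e x z' -> y != z -> y != z' -> z != z' ->
    e y z || e y z'.
  move=> xy xz xz' yz yz' zz'; apply/negPn; rewrite negb_or; apply/negP => /andP[nz nz'].
  have : [set w | e x w && e y w] \subset N :\ y :\ z :\ z'.
    apply/fintype.subsetP => w wC; have := fintype.subsetP (sub y xy) w wC.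
    move: wC; rewrite in_common_nbrs !inE => /andP[xw yw] /andP[-> ->].
    by rewrite !andbT; apply/andP; split; apply: contraTneq yw => ->.
  move/subset_leq_card => /(leq_trans (tri y xy)).
  have := cN y xy; rewrite (cardsD1 z (N :\ y)) (cardsD1 z' (N :\ y :\ z)).
  by rewrite !inE xz xz' (eq_sym z y) yz (eq_sym z' y) yz' (eq_sym z' z) zz'; lia.
have comp : {in N &, forall y z, y != z -> e y z} -> False.
  move=> cp; have us : uniq (x :: enum N) by rewrite /= mem_enum NP ie enum_uniq.
  have ps : pairwise e (x :: enum N).
    rewrite /=; apply/andP; split; first by apply/allP => y; rewrite mem_enum NP.
    apply/(pairwiseP x) => i j; rewrite !inE => si sj ij.
    apply: cp; rewrite -1?mem_enum ?mem_nth //.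
    by rewrite nth_uniq ?enum_uniq // neq_ltn ij.
  apply: (@lattice_planar_K5_free e (take 5 (x :: enum N))) => //.
  - by rewrite size_take /= -cardE; case: ifP => //; lia.
  - by rewrite take_uniq.
  - by have := ps; rewrite -[X in pairwise _ X](cat_take_drop 5) pairwise_cat => /and3P[].
have [/forall_inP cp|] :=
    boolP [forall y in N, [forall z in N, (y != z) ==> e y z]].
  apply: comp => y z yN zN yz; have /forall_inP/(_ z zN) := cp y yN.
  by rewrite yz.
case/forall_inPn => a aN /forall_inPn[b bN]; rewrite negb_imply => /andP[ab nab].
have xa : e x a by rewrite -NP.
have xb : e x b by rewrite -NP.
(* With only four neighbours of [x], the three common neighbours of [x] and [a] would be all the
   others, including [b]. *)
have N5' : #|N| = 5.
  suff: #|N| != 4 by lia.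
  apply/eqP => N4'; have /eqP E : [set w | e x w && e a w] == N :\ a.
    by rewrite eqEcard sub //= cN // N4' tri.
  have := in_common_nbrs e x a b; rewrite E !inE eq_sym ab xb /= => h.
  by rewrite -h in nab.
have C3 : #|N :\ a :\ b| = 3.
  by have := cN a xa; rewrite (cardsD1 b (N :\ a)) !inE eq_sym ab xb N5'; lia.
have /card_gt0P[c cC] : 0 < #|N :\ a :\ b| by rewrite C3.
have /card_gt0P[d dC] : 0 < #|N :\ a :\ b :\ c| by move: C3; rewrite (cardsD1 c) cC; lia.
have /card_gt0P[f fC] : 0 < #|N :\ a :\ b :\ c :\ d|.
  by move: C3; rewrite (cardsD1 c) cC (cardsD1 d) dC; lia.
move: cC dC fC; rewrite !inE => /and3P[cb ca xc] /and4P[dc db da xd].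
move=> /and5P[fd fc fb fa xf].
have ab_adj w : e x w -> w != a -> w != b -> e a w /\ e b w.
  move=> xw wa wb; have := adj a b w xa xb xw ab; rewrite eq_sym wa eq_sym wb.
  rewrite (negPf nab) => /(_ isT isT) aw; have := adj b a w xb xa xw.
  by rewrite eq_sym ab !(eq_sym _ w) wa wb se (negPf nab) => /(_ isT isT isT) bw.
(* Since [a] and [b] are adjacent to all of [c'], [d'], [f'], contracting [a] into [c'] supplies the
   edges from [c'] to [d'] and [f']; then [c'], [b], [d'], [f'], [x] form a K5. *)
have main c' d' f' : e x c' -> e x d' -> e x f' -> c' != a -> c' != b ->
    d' != a -> d' != b -> f' != a -> f' != b -> c' != d' -> c' != f' -> d' != f' ->
    e d' f' -> False.
  move=> xc' xd' xf' ca' cb' da' db' fa' fb' cd' cf' df' edf.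
  have [ac bc] := ab_adj _ xc' ca' cb'; have [ad bd] := ab_adj _ xd' da' db'.
  have [af bf] := ab_adj _ xf' fa' fb'.
  have ec : e c' a by rewrite se.
  apply: (@lattice_planar_K5_free _ [:: c'; b; d'; f'; x]
    (lattice_planar_contract se ec pe)) => //.
    by rewrite /= !inE !negb_or cb' cd' cf' df' !nx // !(eq_sym b) db' fb'.
  have ba : b != a by rewrite eq_sym.
  have xna : x != a by rewrite eq_sym nx.
  rewrite /= !contractE ca' ba da' fa' xna /= cb' cd' cf' df' !nx // !(eq_sym b) db' fb' !eqxx.
  by rewrite ad af bd bf edf (se c' b) bc !(se _ x) xc' xd' xf' xb xa !orbT.
(* One edge among [c], [d], [f] suffices for [main]; if [d] misses [f], it is adjacent to [c]. *)
have [edf|ndf] := boolP (e d f).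
  by apply: (main c d f) => //; rewrite eq_sym.
have := adj d f c xd xf xc; rewrite (negPf ndf) eq_sym fd dc fc => /(_ isT isT isT) /= edc.
by apply: (main f d c) => //.
Qed.

(** Mader's argument on a minimal counterexample, the bound being twice [3 * #|V| - 6]. Deleting an
    edge shows that the bound is exceeded by at most 2, so some vertex [x] has degree at most 5; it
    is not isolated, or it could be removed. Contracting an edge at [x] with at most two common
    neighbours would lose one vertex and at most 6 arcs, against minimality. So every edge at [x]
    lies in three triangles, and [dense_neighborhood_K5] applies. *)
Lemma lattice_planar_card e V : symmetric e -> irreflexive e ->
  (forall x y, e x y -> x \in V) -> 3 <= #|V| -> lattice_planar e ->
  #|arcs e| <= 6 * #|V| - 12.
Proof.
have ltK (e' : rel T) : #|arcs e'| < #|{: T * T}|.+1 by rewrite ltnS max_card.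
(* As [K] exceeds every number of arcs, the measure [#|V| * K + #|arcs e|] drops with each loss of a
   vertex, even if the number of arcs were to grow. *)
move: #|{: T * T}|.+1 ltK => K ltK.
move: {2}(#|V| * K + _) (leqnn (#|V| * K + #|arcs e|)) => m.
elim: m e V => [|m IH] e V le se ie eV V3 pe; first by nia.
rewrite leqNgt; apply/negP => big.
have small := card_arcs_le ie eV se.
have V4 : 4 <= #|V| by case: (#|V|) V3 big small => [|[|[|[|]]]] //= _; lia.
have pos : 0 < #|arcs e| by lia.
have /card_gt0P[[u v]] := pos; rewrite inE /= => uv.
have uv' : u != v by apply: contraTneq uv => ->; rewrite ie.
have del : #|arcs e| <= 6 * #|V| - 10.
  pose e' : rel T := [rel x y | e x y && ((x, y) \notin [set (u, v); (v, u)]%SET)].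
  have sub : subrel e' e by move=> x y /andP[].
  have se' : symmetric e'.
    move=> x y; rewrite /e' /= se; congr (_ && ~~ _).
    by rewrite !inE !xpair_eqE orbC; congr (_ || _); exact: andbC.
  have Ee' : arcs e' = arcs e :\: [set (u, v); (v, u)]%SET.
    by apply/setP => -[x y]; rewrite finset.in_setD [LHS]inE [X in _ && X]inE /= andbC.
  have sub2 : [set (u, v); (v, u)]%SET \subset arcs e.
    by apply/fintype.subsetP => z; rewrite !inE => /orP[]/eqP-> //=; rewrite se.
  have c2 : #|[set (u, v); (v, u)]%SET| = 2.
    by rewrite cards2 xpair_eqE (negPf uv').
  have ce : #|arcs e| = #|arcs e'| + 2.
    by rewrite Ee' -(cardsID [set (u, v); (v, u)]%SET (arcs e)) (finset.setIidPr sub2) c2 addnC.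
  have := IH e' V _ se' _ _ V3 (lattice_planar_sub sub pe); rewrite ce in le *.
  move=> H; suff : #|arcs e'| <= 6 * #|V| - 12 by lia.
  apply: H; first by lia.
    by move=> x; rewrite /e' /= ie.
  by move=> x y /sub/eV.
have lt6 : #|arcs e| < 6 * #|V| by lia.
have [x xV dx] := small_degree eV lt6.
have cVx : #|V :\ x| = #|V|.-1 by rewrite (cardsD1 x V) xV.
have ltm a : a < K -> #|V|.-1 * K + a <= m.
  move=> aK; have : #|V| * K = #|V|.-1 * K + K by rewrite -mulSnr prednK //; lia.
  by move: (_ * K) (_ * K) le => A B; lia.
have [d0|dpos] := posnP #|[set y | e x y]|.
  have nx y : ~~ e x y by have /eqP := d0; rewrite cards_eq0 => /eqP/setP/(_ y); rewrite !inE => ->.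
  have eV' y z : e y z -> y \in V :\ x.
    by move=> yz; rewrite !inE (eV y z yz) andbT; apply: contraTneq yz => ->.
  have := IH e (V :\ x) _ se ie eV' _ pe; rewrite cVx => /(_ (ltm _ (ltK e))).
  by move=> /(_ ltac:(lia)); lia.
apply: (@dense_neighborhood_K5 e x se ie pe); first by rewrite dpos.
move=> y xy; rewrite leqNgt; apply/negP => tri.
have ccard := card_arcs_contract se ie xy.
have eVy a b : contract x y e a b -> a \in V :\ y.
  rewrite contractE !inE => /and4P[-> _ _ /or3P[/eV //|/andP[/eqP-> _]|/andP[_ /eV]]] //.
have yV : y \in V by apply: (eV y x); rewrite se.
have cVy : #|V :\ y| = #|V|.-1 by rewrite (cardsD1 y V) yV.
have ltc := ltK (contract x y e).
have := IH (contract x y e) (V :\ y) _ (contract_sym x y se) _ eVy _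
  (lattice_planar_contract se xy pe).
have ic : irreflexive (contract x y e) by move=> a; rewrite contractE eqxx !andbF.
by rewrite cVy => /(_ (ltm _ ltc) ic ltac:(lia)); lia.
Qed.

End LatticePlanar.

(** * From topological drawings to the lattice *)

Lemma set2_eq (T : finType) (x y x' y' : T) : [set x; y]%SET = [set x'; y']%SET ->
  (x = x' /\ y = y') \/ (x = y' /\ y = x').
Proof.
move=> E; have := (set21 x y, set22 x y, set21 x' y', set22 x' y').
rewrite E -{3 4}E !inE => -[[[]]].
by do 4![case/orP=> /eqP ?]; subst; auto.
Qed.

Section PlanarToLattice.
Import Order.TTheory GRing.Theory Num.Theory numFieldNormedType.Exports.
Local Open Scope classical_set_scope.
Local Open Scope ring_scope.
Variable R : realType.

(** * Separation of disjoint compact sets and uniform continuity *)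

Lemma near_disjoint_compact (M : pseudoMetricType R) (K B : set M) :
  compact K -> closed B -> (forall x, K x -> ~ B x) ->
  \forall d \near 0^'+, forall a b, K a -> B b -> ~ ball a d b.
Proof.
move=> cK cB KB.
have : near_covering K by apply/compact_near_coveringP.
move/(_ _ (0^'+ : set_system R) (fun d a => forall b, B b -> ~ ball a d b) _).
suff H : forall x : M, K x ->
    \forall x' \near x & i \near 0^'+, forall b : M, B b -> ~ ball x' i b.
  by move/(_ H); apply: filterS => d h a b Ka; apply: h.
move=> a Ka; have : nbhs a (~` B).
  by apply: open_nbhs_nbhs; split; [exact: closed_openC|exact: KB].
rewrite -nbhs_ballE => -[r /= r0 rB].
exists (ball a (r / 2), [set d | d < r / 2]).
  by split; [exact: nbhsx_ballx_half || (apply: nbhsx_ballx; lra)|apply: nbhs_right_lt; lra].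
move=> [x' d] [/= ax' dr] b Bb x'b; apply: (rB b) => //.
by apply: (@ball_split _ _ x') => //; apply: le_ball x'b; lra.
Qed.

(** The Heine-Cantor theorem on the unit interval: near each point half of a local modulus works,
    and compactness gives a common one. *)
Lemma uniform_continuity_segment (M : pseudoMetricType R) (f : R -> M) (d : R) :
  {within `[0, 1], continuous f} -> 0 < d ->
  exists2 r : R, 0 < r & forall s t, s \in `[0, 1] -> t \in `[0, 1] ->
    `|s - t| < r -> ball (f s) d (f t).
Proof.
move=> cf d0; have : near_covering_within [set` `[(0 : R), 1]].
  by apply/near_covering_withinP/compact_near_coveringP/segment_compact.
move/(_ _ (0^'+ : set_system R) (fun r s => forall t, t \in `[0, 1] ->
    `|s - t| < r -> ball (f s) d (f t)) _).
suff H : forall x : R, x \in `[0, 1] ->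
    \forall x' \near x & i \near 0^'+, x' \in `[0, 1] ->
      forall t, t \in `[0, 1] -> `|x' - t| < i -> ball (f x') d (f t).
  move/(_ H) => {}H.
  have [r [r0 hr]] : exists r : R, 0 < r /\ (forall s t, s \in `[0, 1] ->
      t \in `[0, 1] -> `|s - t| < r -> ball (f s) d (f t)).
    near (0 : R)^'+ => r; exists r; split=> //.
    by move=> s t sI; move: s sI t; near: r.
  by exists r.
move=> s sI; have /subspace_continuousP/(_ s sI) := cf.
move=> /(_ (ball (f s) (d / 2))).
have d20 : 0 < d / 2 by lra.
move=> /(_ (nbhsx_ballx _ _ d20)).
rewrite /within /= /fmap /= => /nbhs_ballP[r /= r0 hr].
exists (ball s (r / 2), [set i | i < r / 2]).
  by split; [apply: nbhsx_ballx; lra|apply: nbhs_right_lt; lra].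
move=> [x' i] [/= sx' ir] x'I t tI x't.
apply: (@ball_splitr _ _ (f s)); apply: hr => //.
  by apply: le_ball sx'; lra.
by apply: (@ball_split _ _ x') => //; rewrite /ball /=; lra.
Unshelve. all: by end_near. Qed.


(** Lattice points close to the curve magnified by [1 / d]. The slack 2 also admits the corner point
    needed to walk between two diagonally neighbouring cells. *)
Definition near_curve (f : R -> R * R) (d : R) (q : int * int) : Prop :=
  exists2 t, t \in `[0, 1] &
    `|(f t).1 / d - q.1%:~R| <= 2 /\ `|(f t).2 / d - q.2%:~R| <= 2.

Definition cell (d : R) (p : R * R) : int * int :=
  (Num.floor (p.1 / d), Num.floor (p.2 / d)).

Lemma floor_dist (x y : R) : `|x - y| < 1 ->
  [/\ `|x - (Num.floor x)%:~R| <= 2, `|x - (Num.floor y)%:~R| <= 2 &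
      [\/ Num.floor y = Num.floor x, Num.floor y = Num.floor x + 1 |
          Num.floor x = Num.floor y + 1]].
Proof.
have := floor_itv x; have := floor_itv y; rewrite !rmorphD /=.
move=> /andP[y1 y2] /andP[x1 x2]; rewrite !ltr_norml !ler_norml => /andP[xy1 xy2].
split; [by apply/andP; split; lra|by apply/andP; split; lra|].
have h1 : Num.floor y < Num.floor x + 2 by rewrite -(ltr_int R) rmorphD /=; lra.
have h2 : Num.floor x < Num.floor y + 2 by rewrite -(ltr_int R) rmorphD /=; lra.
have : [|| Num.floor y == Num.floor x, Num.floor y == Num.floor x + 1 |
          Num.floor x == Num.floor y + 1] by lia.
by case/or3P=> /eqP; [constructor 1|constructor 2|constructor 3].
Qed.

Lemma joined_unit (S : int * int -> Prop) (a b a' b' : int) :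
  [\/ a' = a, a' = a + 1 | a = a' + 1] -> [\/ b' = b, b' = b + 1 | b = b' + 1] ->
  S (a, b) -> S (a', b) -> S (a', b') -> joined S (a, b) (a', b').
Proof.
move=> ha hb S1 S2 S3; apply: (@joined_trans _ _ (a', b)).
  case: ha => E; first by rewrite -E; apply: joined_refl.
    by apply: joined_step => //; rewrite /ladj /=; lia.
  by apply: joined_step => //; rewrite /ladj /=; lia.
case: hb => E; first by rewrite -E; apply: joined_refl.
  by apply: joined_step => //; rewrite /ladj /=; lia.
by apply: joined_step => //; rewrite /ladj /=; lia.
Qed.

Lemma joined_cells (f : R -> R * R) (d s t : R) : 0 < d ->
  s \in `[0, 1] -> t \in `[0, 1] -> ball (f s) d (f t) ->
  joined (near_curve f d) (cell d (f s)) (cell d (f t)).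
Proof.
move=> d0 sI tI [/= b1 b2].
have h (x y : R) : `|x - y| < d -> `|x / d - y / d| < 1.
  by move=> xy; rewrite -mulrBl normrM normfV (gtr0_norm d0) ltr_pdivrMr ?mul1r.
have h' (x y : R) : `|x - y| < d -> `|y / d - x / d| < 1.
  by move=> xy; rewrite distrC; apply: h.
have [x1 x2 x3] := floor_dist (h _ _ b1); have [y1 y2 y3] := floor_dist (h _ _ b2).
have [x1' _ _] := floor_dist (h' _ _ b1); have [y1' _ _] := floor_dist (h' _ _ b2).
by apply: joined_unit => //; [exists s|exists s|exists t].
Qed.

(** Sample the curve at equal steps shorter than a modulus of uniform continuity for [d];
    consecutive samples lie in equal or neighbouring cells. *)
Lemma joined_curve (f : R -> R * R) (d : R) : 0 < d ->
  {within `[0, 1], continuous f} ->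
  joined (near_curve f d) (cell d (f 0)) (cell d (f 1)).
Proof.
move=> d0 cf; have [r r0 hr] := uniform_continuity_segment cf d0.
have [N Nr] : exists N : nat, r^-1 < N.+1%:R.
  by exists (Num.trunc r^-1); exact: truncnS_gt.
have N0 : 0 < N.+1%:R :> R by rewrite ltr0n.
suff H (i : nat) : (i <= N.+1)%N ->
    joined (near_curve f d) (cell d (f 0)) (cell d (f (i%:R / N.+1%:R))).
  by have := H N.+1 (leqnn _); rewrite divff // gt_eqF.
have I01 (j : nat) : (j <= N.+1)%N -> j%:R / N.+1%:R \in `[(0 : R), 1].
  by move=> jN; rewrite in_itv /= divr_ge0 //= ler_pdivrMr // mul1r ler_nat.
elim: i => [_|i IH iN].
  rewrite mul0r; apply: joined_cells => //; last exact: ballxx.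
    by rewrite in_itv /= lexx ler01.
  by rewrite in_itv /= lexx ler01.
apply: joined_trans (IH (ltnW iN)) _; apply: joined_cells => //.
- exact/I01/ltnW.
- exact: I01.
- apply: hr; [exact/I01/ltnW|exact: I01|].
  rewrite -mulrBl -natr1 opprD addNKr mulN1r normrN normfV gtr0_norm //.
  by rewrite -(invrK r) ltf_pV2 // posrE invr_gt0.
Qed.

(** Both magnified points are within 2 of [q], hence within 4 of each other; the constant 5 makes
    the inequality strict. *)
Lemma near_curve_meet (f g : R -> R * R) (d : R) (q : int * int) : 0 < d ->
  near_curve f d q -> near_curve g d q ->
  exists s t, [/\ s \in `[0, 1], t \in `[0, 1] & ball (f s) (5 * d) (g t)].
Proof.
move=> d0 [s sI [s1 s2]] [t tI [t1 t2]]; exists s, t; split=> //.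
have h (x y z : R) : `|x / d - z| <= 2 -> `|y / d - z| <= 2 -> `|x - y| < 5 * d.
  rewrite !ler_norml => /andP[h1 h2] /andP[h3 h4].
  have -> : x - y = (x / d - y / d) * d by rewrite mulrBl !divfK // gt_eqF.
  rewrite normrM (gtr0_norm d0) ltr_pM2r // ltr_norml.
  by apply/andP; split; lra.
by split; [exact: h s1 t1|exact: h s2 t2].
Qed.

(** The finitely many pairs of disjoint edges have arcs at a common positive distance [r]. Rounding
    at mesh [r / 5] then keeps their lattice neighbourhoods disjoint. *)
Lemma planar_lattice_planar (T : finType) (G : sgraph T) : planar R G ->
  lattice_planar [rel x y | [set x; y]%SET \in edges G].
Proof.
move=> [pt [arc [pinj carc ends inner cross]]].
have cpt e : e \in edges G -> compact (arc e @` `[0, 1]).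
  by move=> /carc[ce _]; apply: continuous_compact => //; exact: segment_compact.
(* The hypotheses separate interiors from each other and from vertices; end points of disjoint edges
   differ because [pt] is injective. *)
have disj e f : e \in edges G -> f \in edges G -> (e :&: f)%SET == finset.set0 ->
    forall s t, s \in `[0, 1] -> t \in `[0, 1] -> arc e s <> arc f t.
  move=> eG fG ef s t sI tI Est.
  have Eend g u : g \in edges G -> u \in `[0, 1] ->
      (u \in `]0, 1[) \/ (exists2 v, v \in g & arc g u = pt v).
    move=> gG; have [x [y [Eg a0 a1]]] := ends g gG.
    rewrite !in_itv /= !le_eqVlt => /andP[/orP[/eqP<-|u0] /orP[/eqP u1|u1]].
    - by right; exists x; rewrite // Eg !inE eqxx.
    - by right; exists x; rewrite // Eg !inE eqxx.
    - by right; exists y; rewrite ?u1 // Eg !inE eqxx orbT.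
    - by left; rewrite u0 u1.
  have nef : e <> f.
    move=> E; have [x [y [Ee _ _]]] := ends e eG; have /eqP/setP/(_ x) := ef.
    by rewrite -E Ee !inE eqxx.
  have [sI'|[v ve Ev]] := Eend e s eG sI; have [tI'|[w wf Ew]] := Eend f t fG tI.
  - exact: (cross e f s t).
  - by apply: (inner e s w) => //; rewrite Est.
  - by apply: (inner f t v) => //; rewrite -Est.
  - have vw : v = w by apply: pinj; rewrite -Ev -Ew.
    by have /eqP/setP/(_ v) := ef; rewrite !inE ve vw wf.
have sep : \forall d \near 0^'+, forall ef : {set T} * {set T},
    ef.1 \in edges G -> ef.2 \in edges G -> (ef.1 :&: ef.2)%SET == finset.set0 ->
    forall a b, (arc ef.1 @` `[0, 1]) a -> (arc ef.2 @` `[0, 1]) b -> ~ ball a d b.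
  apply: filter_forall => -[e f] /=.
  have [eG|] := boolP (e \in edges G); last by move=> _; apply: nearW.
  have [fG|] := boolP (f \in edges G); last by move=> _; apply: nearW.
  have [ef|] := boolP ((e :&: f)%SET == finset.set0); last by move=> _; apply: nearW.
  have KB x : (arc e @` `[0, 1]) x -> ~ (arc f @` `[0, 1]) x.
    by move=> [s sI <-] [t tI] /esym; apply: disj.
  have cf := compact_closed (@norm_hausdorff _ _) (cpt f fG).
  by apply: filterS (near_disjoint_compact (cpt e eG) cf KB) => d H _ _ _.
have [r [r0 hr]] : exists r : R, 0 < r /\ forall ef : {set T} * {set T},
    ef.1 \in edges G -> ef.2 \in edges G -> (ef.1 :&: ef.2)%SET == finset.set0 ->
    forall a b, (arc ef.1 @` `[0, 1]) a -> (arc ef.2 @` `[0, 1]) b -> ~ ball a r b.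
  by near (0 : R)^'+ => r; exists r; split=> //; near: r.
have d0 : 0 < r / 5 by lra.
exists (cell (r / 5) \o pt), (fun x y => near_curve (arc [set x; y]%SET) (r / 5)).
split=> [x y /= xy|x y z t q /= xy zt dis S1 S2].
  have [x' [y' [E a0 a1]]] := ends _ xy; have [ca _] := carc _ xy.
  have := joined_curve d0 ca; rewrite a0 a1.
  by case: (set2_eq E) => -[-> ->] // /joined_sym.
have [s [u [sI uI b]]] := near_curve_meet d0 S1 S2.
apply: (hr (([set x; y], [set z; t])%SET) xy zt _ (arc _ s) (arc _ u)) => /=.
- move/and4P: dis => [xz xt yz yt]; apply/eqP/setP => w; rewrite !inE.
  by apply/negP => /andP[/orP[]/eqP-> /orP[]/eqP E]; move: xz xt yz yt; rewrite E eqxx.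
- by exists s.
- by exists u.
- by move: b; rewrite mulrC divfK.
Unshelve. all: by end_near. Qed.

Lemma planar_card (n : nat) (G : sgraph 'I_n) : (3 <= n)%N -> planar R G ->
  (#|edges G| <= 3 * n - 6)%N.
Proof.
move=> n3 /planar_lattice_planar pG; set e : rel 'I_n := [rel x y | _] in pG.
have c2 (f : {set 'I_n}) : f \in edges G -> #|f| = 2%N.
  by move=> fG; have /forall_inP/(_ f fG)/eqP := edges_card2 G.
have se : symmetric e by move=> x y; rewrite /e /= finset.setUC.
have ie : irreflexive e.
  by move=> x; apply/negP => /c2; rewrite finset.setUid cards1.
have := @lattice_planar_card _ e [set: 'I_n]%SET se ie _ _ pG.
rewrite cardsT card_ord => /(_ (fun x _ _ => finset.in_setT x) n3).
(* Grouping arcs by their underlying edge, each group contains both orientations. *)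
suff : (2 * #|edges G| <= #|arcs e|)%N by lia.
rewrite -[#|arcs e|]sum1_card.
rewrite (partition_big (fun xy : 'I_n * 'I_n => [set xy.1; xy.2]%SET) (mem (edges G))) /=;
  last by move=> [x y]; rewrite inE.
rewrite mulnC -sum_nat_const; apply: leq_sum => f fG.
have /cards2P[x [y [xy Ef]]] : #|f| == 2%N by rewrite c2.
rewrite sum1dep_card; have <- : #|[set (x, y); (y, x)]%SET| = 2%N.
  by rewrite cards2 xpair_eqE (negPf xy).
apply/subset_leq_card/fintype.subsetP => z; rewrite !inE => /orP[]/eqP-> /=.
  by rewrite /e /= -Ef fG eqxx.
by rewrite /e /= finset.setUC -Ef fG eqxx.
Qed.

End PlanarToLattice.

(** * Stacked antiprisms and their 4-cycles *)

Section StackedAntiprisms.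
Import Order.TTheory GRing.Theory Num.Theory.
Local Open Scope ring_scope.
Variable m : nat.
Hypothesis m2 : (2 <= m)%N.

Local Notation Zk := 'I_m.+3.

Lemma natr_Zk_inj (a b : nat) : (a < m.+3)%N -> (b < m.+3)%N ->
  a%:R = b%:R :> Zk -> a = b.
Proof. by move=> am bm /(congr1 val); rewrite /= !Zp_nat /= !modn_small. Qed.

Lemma natr_Zk0 : m.+3%:R = 0 :> Zk.
Proof. by rewrite Zp_nat; apply: val_inj; exact: modnn. Qed.

Lemma intr_Zk_eq0 (z : int) : (`|z| < m.+3)%N -> z%:~R = 0 :> Zk -> z = 0.
Proof.
case: z => n /= nm; first by move/(@natr_Zk_inj n 0 nm isT) => ->.
by rewrite NegzE rmorphN /= => /eqP; rewrite oppr_eq0 => /eqP/(@natr_Zk_inj n.+1 0 nm isT).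
Qed.

Definition vertex : finType := (bool + 'I_m * Zk)%type.

(* The m rings have levels 1, ..., m; levels 0 and m + 1 are the two poles. *)
Definition vtx (l : nat) (i : Zk) : vertex :=
  if l is l'.+1 then if insub l' is Some j then inr (j, i) else inl true
  else inl false.

Definition lev (v : vertex) : nat :=
  match v with inl b => if b then m.+1 else 0%N | inr ji => ji.1.+1 end.

(** A pole has no position of its own; [0] is a default value. *)
Definition pos (v : vertex) : Zk := if v is inr ji then ji.2 else 0.

Definition on_ring (v : vertex) : bool := (0 < lev v <= m)%N.

Lemma lev_vtx l i : (l <= m.+1)%N -> lev (vtx l i) = l.
Proof.
case: l => [//|l] /= lm; case: insubP => [j _ /= -> //|/=].
by move=> ?; lia.
Qed.

Lemma pos_vtx l i : (0 < l <= m)%N -> pos (vtx l i) = i.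
Proof. by case: l => [//|l] /= lm; case: insubP => [j _ _ //|/=]; lia. Qed.

Lemma lev_le v : (lev v <= m.+1)%N.
Proof. by case: v => [[]|[j i]] //=; have := ltn_ord j; lia. Qed.

Lemma vertex_eq u v : lev u = lev v -> (on_ring u -> pos u = pos v) -> u = v.
Proof.
rewrite /on_ring; case: u v => [b|[j i]] [b'|[j' i']] /=.
- by case: b b' => [] [].
- by have := ltn_ord j'; case: b => //; lia.
- by have := ltn_ord j; case: b' => //; lia.
- have jm := ltn_ord j; move=> [jj'] /(_ _) ->; last by lia.
  by congr (inr (_, _)); apply: val_inj.
Qed.

#[global] Arguments vtx : simpl never.
#[global] Arguments lev : simpl never.
#[global] Arguments pos : simpl never.

Lemma card_vertex : #|{: vertex}| = (2 + m * m.+3)%N.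
Proof. by rewrite card_sum card_prod !card_ord card_bool. Qed.

(** Three families: ring edges, vertical edges including those at the poles, and diagonals between
    consecutive rings. With [k = m + 3] their number is [k m + k (m + 1) + k (m - 1) = 3 k m]. *)
Definition edge_index : finType :=
  ('I_m * Zk + 'I_m.+1 * Zk + 'I_m.-1 * Zk)%type.

Definition src (x : edge_index) : vertex :=
  match x with
  | inl (inl (j, i)) => vtx j.+1 i
  | inl (inr (j, i)) => vtx j i
  | inr (j, i) => vtx j.+1 i
  end.

Definition tgt (x : edge_index) : vertex :=
  match x with
  | inl (inl (j, i)) => vtx j.+1 (i + 1)
  | inl (inr (j, i)) => vtx j.+1 i
  | inr (j, i) => vtx j.+2 (i - 1)
  end.

Definition ecol (x : edge_index) : nat :=
  match x with
  | inl (inl (j, i)) => i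
  | inl (inr (j, i)) => nat_of_ord ((i : Zk) + j.+1%:R)
  | inr (j, i) => (m.+3 + j.+1)%N
  end.

Lemma card_edge_index : #|{: edge_index}| = (3 * #|{: vertex}| - 6)%N.
Proof.
rewrite card_vertex !card_sum !card_prod !card_ord.
by case: m m2 => [|m'] //= _; lia.
Qed.

(** * Directions, as changes of level and position, and colours around a ring vertex *)

Definition dirs : seq (int * int) :=
  [:: (0, 1); (0, -1); (1, 0); (-1, 0); (1, -1); (-1, 1)].

(** Colour of the edge leaving position [i] of level [l] in direction [d]. All colours of ring and
    vertical edges are written as [i] plus a natural offset, with [m + 2] for -1 modulo [m + 3], so
    that comparing them amounts to comparing offsets. *)
Definition dcol (l : nat) (i : Zk) (d : int * int) : nat :=
  if d == (1, -1) then (m.+3 + l)%N else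
  if d == (-1, 1) then (m.+3 + l.-1)%N else
  nat_of_ord (i + (if d == (0, 1) then 0%N else if d == (0, -1) then m.+2 else
               if d == (1, 0) then l.+1 else l)%:R).

Lemma dcol_right l i : dcol l i (0, 1) = i.
Proof. by change (nat_of_ord (i + 0%:R) = i); rewrite mulr0n addr0. Qed.

Lemma dcol_left l i : dcol l i (0, -1) = nat_of_ord (i - 1).
Proof.
change (nat_of_ord (i + m.+2%:R) = nat_of_ord (i - 1)); congr nat_of_ord.
by have := natr_Zk0; rewrite -(natr1 m.+2) => /eqP; rewrite addr_eq0 => /eqP->.
Qed.

Lemma dcol_up l i : dcol l i (1, 0) = nat_of_ord (i + l.+1%:R).
Proof. by []. Qed.

Lemma dcol_down l i : dcol l i (-1, 0) = nat_of_ord (i + l%:R).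
Proof. by []. Qed.

Lemma dcol_diag_up l i : dcol l i (1, -1) = (m.+3 + l)%N.
Proof. by []. Qed.

Lemma dcol_diag_down l i : dcol l i (-1, 1) = (m.+3 + l.-1)%N.
Proof. by []. Qed.

Definition dcolE := (dcol_right, dcol_left, dcol_up, dcol_down, dcol_diag_up, dcol_diag_down).

Definition adj (a b : vertex) (c : nat) : Prop :=
  exists2 x, ecol x = c & (a = src x /\ b = tgt x) \/ (a = tgt x /\ b = src x).

Lemma adj_sym a b c : adj a b c -> adj b a c.
Proof. by move=> [x xc [[]|[]] -> ->]; exists x => //; [right|left]. Qed.

Lemma adj_ring a b c : on_ring a -> adj a b c -> exists2 d, d \in dirs &
  [/\ (lev b)%:Z = (lev a)%:Z + d.1, on_ring b -> pos b = pos a + d.2%:~R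
    & c = dcol (lev a) (pos a) d].
Proof.
move=> ra [x <-]; case: x => [[] [j i]|[j i]] /=; have jm := ltn_ord j.
- move=> [[Ea ->]|[Ea ->]]; rewrite /on_ring Ea !lev_vtx ?pos_vtx; try lia.
    by exists (0, 1); rewrite // dcolE; split; [rewrite /=; lia| |].
  by exists (0, -1); rewrite // dcolE addrK; split; [rewrite /=; lia| |].
- move=> [[Ea ->]|[Ea ->]]; move: ra; rewrite /on_ring Ea !lev_vtx; try lia.
    move=> ra; exists (1, 0) => //; split; first by rewrite /=; lia.
      by move=> rb; rewrite !pos_vtx // mulr0z addr0.
    by rewrite pos_vtx // dcolE.
  move=> ra; exists (-1, 0) => //; split; first by rewrite /=; lia.
    by move=> rb; rewrite !pos_vtx // mulr0z addr0.
  by rewrite pos_vtx // dcolE.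
- move=> [[Ea ->]|[Ea ->]]; rewrite /on_ring Ea !lev_vtx ?pos_vtx; try lia.
    by exists (1, -1); rewrite // dcolE; split=> //; rewrite /=; lia.
  by exists (-1, 1); rewrite // dcolE; split; [rewrite /=; lia|rewrite subrK|].
Qed.

Lemma adj_bottom a b c : lev a = 0%N -> adj a b c ->
  [/\ on_ring b, lev b = 1%N & c = nat_of_ord (pos b + 1)].
Proof.
move=> a0 [x <-]; case: x => [[] [j i]|[j i]] /=; have jm := ltn_ord j.
- by move=> [[Ea _]|[Ea _]]; move: a0; rewrite Ea lev_vtx; lia.
- move=> [[Ea ->]|[Ea ->]]; move: a0; rewrite Ea lev_vtx //; try lia.
  move=> j0; rewrite /on_ring lev_vtx; last by lia.
  by rewrite pos_vtx; last lia; rewrite j0; split=> //; lia.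
- by move=> [[Ea _]|[Ea _]]; move: a0; rewrite Ea lev_vtx; lia.
Qed.

Lemma adj_top a b c : lev a = m.+1 -> adj a b c ->
  [/\ on_ring b, lev b = m & c = nat_of_ord (pos b + m.+1%:R)].
Proof.
move=> a0 [x <-]; case: x => [[] [j i]|[j i]] /=; have jm := ltn_ord j.
- by move=> [[Ea _]|[Ea _]]; move: a0; rewrite Ea lev_vtx; lia.
- move=> [[Ea ->]|[Ea ->]]; move: a0; rewrite Ea lev_vtx //; try lia.
  move=> [jm']; rewrite /on_ring lev_vtx; last by lia.
  by rewrite pos_vtx; last lia; rewrite jm'; split=> //; lia.
- by move=> [[Ea _]|[Ea _]]; move: a0; rewrite Ea lev_vtx; lia.
Qed.

Lemma lev_cases v : [\/ on_ring v, lev v = 0%N | lev v = m.+1].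
Proof.
have : [|| on_ring v, lev v == 0%N | lev v == m.+1].
  by rewrite /on_ring; have := lev_le v; lia.
by case/or3P=> [|/eqP|/eqP]; [constructor 1|constructor 2|constructor 3].
Qed.

Let dcol_off l i : (dcol l i (0, 1) = nat_of_ord (i + 0%:R)) *
  (dcol l i (0, -1) = nat_of_ord (i + m.+2%:R)).
Proof. by []. Qed.

(** For [1 <= l <= m] the offsets [0], [m + 2], [l + 1] and [l] are distinct and below [m + 3]; the
    two diagonal colours differ and are at least [m + 3]. *)
Lemma dcol_inj l i : (0 < l <= m)%N -> {in dirs &, injective (dcol l i)}.
Proof.
move=> lm d d'.
have offi (a b : nat) : (a < m.+3)%N -> (b < m.+3)%N ->
    nat_of_ord (i + a%:R) = nat_of_ord (i + b%:R) -> a = b.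
  by move=> am bm /val_inj/addrI; apply: natr_Zk_inj.
have lt (z : Zk) := ltn_ord z.
rewrite !inE => /or4P[/eqP->|/eqP->|/eqP->|/or3P[/eqP->|/eqP->|/eqP->]];
  move=> /or4P[/eqP->|/eqP->|/eqP->|/or3P[/eqP->|/eqP->|/eqP->]] //;
  rewrite ?dcol_off ?dcolE.
all: try by move/offi => H; exfalso; have := H ltac:(lia) ltac:(lia); lia.
all: try by move=> E; exfalso; move: E;
  match goal with |- context[nat_of_ord ?z] => have := lt z end; lia.
all: by move=> E; exfalso; lia.
Qed.

(** Properness of the colouring. At a ring vertex the colour determines the direction, at a pole the
    position of the other end. *)
Lemma adj_color_inj a b b' c : adj a b c -> adj a b' c -> b = b'.
Proof.
case: (lev_cases a) => ra ab ab'.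
- have [d dD [lb pb E]] := adj_ring ra ab; have [d' dD' [lb' pb' E']] := adj_ring ra ab'.
  have dd' : d = d' by apply: (dcol_inj (i := pos a) ra) => //; rewrite -E.
  have ll : lev b = lev b' by rewrite -dd' in lb'; lia.
  apply: vertex_eq => // rb; rewrite pb // pb' -?dd' //.
  by rewrite /on_ring -ll.
- have [rb lb E] := adj_bottom ra ab; have [rb' lb' E'] := adj_bottom ra ab'.
  apply: vertex_eq; first by rewrite lb lb'.
  by move=> _; have /val_inj/addIr := etrans (esym E) E'.
- have [rb lb E] := adj_top ra ab; have [rb' lb' E'] := adj_top ra ab'.
  apply: vertex_eq; first by rewrite lb lb'.
  by move=> _; have /val_inj/addIr := etrans (esym E) E'.
Qed.

(** * The 4-cycles of the stacked antiprism *)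

Let opp_dir (d : int * int) : int * int := (- d.1, - d.2).

Let opp_dirE : (opp_dir (0, 1) = (0, -1)) * (opp_dir (0, -1) = (0, 1)) *
  (opp_dir (1, 0) = (-1, 0)) * (opp_dir (-1, 0) = (1, 0)) *
  (opp_dir (1, -1) = (-1, 1)) * (opp_dir (-1, 1) = (1, -1)).
Proof. by []. Qed.

(** In the triangular lattice a closed walk of four steps that does not backtrack at its first two
    turns bounds a rhombus; all [6 ^ 4] choices are tested. *)
Lemma closed_walk_dirs : all (fun d1 => all (fun d2 => all (fun d3 => all (fun d4 =>
    [&& d1.1 + d2.1 + d3.1 + d4.1 == 0, d1.2 + d2.2 + d3.2 + d4.2 == 0,
        d2 != opp_dir d1 & d3 != opp_dir d2] ==>
    [&& d3 == opp_dir d1, d4 == opp_dir d2 & d2 != d1])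
  dirs) dirs) dirs) dirs.
Proof. by vm_compute. Qed.

Lemma dirs_small (d : int * int) : d \in dirs -> (`|d.1| <= 1)%N /\ (`|d.2| <= 1)%N.
Proof.
by rewrite !inE => /or4P[/eqP->|/eqP->|/eqP->|/or3P[/eqP->|/eqP->|/eqP->]].
Qed.

Lemma levR (l l' : nat) (z : int) : l'%:Z = l%:Z + z -> l'%:R = l%:R + z%:~R :> Zk.
Proof. by move=> /(congr1 (fun t : int => t%:~R : Zk)); rewrite rmorphD. Qed.

(** The cycle is a rhombus. With ring and vertical sides, its ring edges agree in colour; with ring
    and diagonal sides, its diagonals do; with vertical and diagonal sides, its vertical edges
    do. *)
Lemma ring_C4 a b c d c1 c2 c3 c4 :
  on_ring a -> on_ring b -> on_ring c -> on_ring d -> a <> c -> b <> d ->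
  adj a b c1 -> adj b c c2 -> adj c d c3 -> adj d a c4 -> c1 = c3 \/ c2 = c4.
Proof.
move=> ra rb rc rd ac bd ab bc cd da.
have [d1 D1 [l1 /(_ rb) p1 E1]] := adj_ring ra ab.
have [d2 D2 [l2 /(_ rc) p2 E2]] := adj_ring rb bc.
have [d3 D3 [l3 /(_ rd) p3 E3]] := adj_ring rc cd.
have [d4 D4 [l4 /(_ ra) p4 E4]] := adj_ring rd da.
have s1 : d1.1 + d2.1 + d3.1 + d4.1 == 0 by lia.
(* The total change of position is at most 4 in absolute value and rings have length at least 5, so
   the cycle cannot wind around a ring. *)
have s2 : d1.2 + d2.2 + d3.2 + d4.2 == 0.
  have [_ q1] := dirs_small D1; have [_ q2] := dirs_small D2.
  have [_ q3] := dirs_small D3; have [_ q4] := dirs_small D4.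
  apply/eqP/intr_Zk_eq0.
    by move: q1 q2 q3 q4 m2; clear; case: d1 d2 d3 d4 => [? x1] [? x2] [? x3] [? x4] /=; lia.
  apply: (addrI (pos a)); rewrite addr0 [RHS]p4 p3 p2 p1.
  by rewrite !rmorphD /= !addrA.
have n1 : d2 != opp_dir d1.
  apply/eqP => E; apply: ac; apply: vertex_eq; first by move: l1 l2; rewrite E /=; lia.
  by move=> _; rewrite p2 p1 E rmorphN /= addrK.
have n2 : d3 != opp_dir d2.
  apply/eqP => E; apply: bd; apply: vertex_eq; first by move: l2 l3; rewrite E /=; lia.
  by move=> _; rewrite p3 p2 E rmorphN /= addrK.
have /allP/(_ d1 D1)/allP/(_ d2 D2)/allP/(_ d3 D3)/allP/(_ d4 D4) := closed_walk_dirs.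
rewrite s1 s2 n1 n2 /= => /and3P[/eqP e3 /eqP e4 n3].
have la : (0 < lev a)%N by case/andP: ra.
have lb : (0 < lev b)%N by case/andP: rb.
have lc : (0 < lev c)%N by case/andP: rc.
have ld : (0 < lev d)%N by case/andP: rd.
have Lb := levR l1; have Lc := levR l2; have Ld := levR l3.
move: n1 n3 e3 e4 l1 l2 l3 Lb Lc Ld p1 p2 p3 E1 E2 E3 E4.
move: D1 D2; rewrite !inE.
move=> /or4P[/eqP->|/eqP->|/eqP->|/or3P[/eqP->|/eqP->|/eqP->]];
  move=> /or4P[/eqP->|/eqP->|/eqP->|/or3P[/eqP->|/eqP->|/eqP->]] // _ _ -> ->;
  rewrite !opp_dirE /= => l1 l2 l3 Lb Lc Ld p1 p2 p3; rewrite !dcolE => -> -> -> ->;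
  first [by left; lia | by right; lia
        | by left; congr nat_of_ord; rewrite -?natr1 ?Lc ?Lb ?p2 ?p1; ring
        | by right; congr nat_of_ord; rewrite -?natr1 ?Ld ?Lc ?Lb ?p3 ?p2 ?p1; ring].
Qed.

(** If [c] is on level 1, the other vertices have consecutive positions [i], [i + 1], [i + 2], and
    the pole edge at [i] agrees with the ring edge from [i + 1] to [i + 2]. If [c] is on level 2 at
    position [i], its vertical edge has colour [i + 2], like the pole edge at [i + 1]. *)
Lemma bottom_C4 a b c d c1 c2 c3 c4 :
  lev a = 0%N -> on_ring c -> b <> d ->
  adj a b c1 -> adj b c c2 -> adj c d c3 -> adj d a c4 -> c1 = c3 \/ c2 = c4.
Proof.
move=> la rc bd ab bc cd /adj_sym ad.
have [rb lb E1] := adj_bottom la ab; have [rd ld E4] := adj_bottom la ad.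
have [d2 D2 [l2 /(_ rc) p2 E2]] := adj_ring rb bc.
have [d3 D3 [l3 /(_ rd) p3 E3]] := adj_ring rc cd.
have n2 : d3 != opp_dir d2.
  apply/eqP => E; apply: bd; apply: vertex_eq; first by rewrite lb ld.
  by move=> _; rewrite p3 p2 E rmorphN /= addrK.
have lc : (0 < lev c)%N by case/andP: rc.
have Lc := levR l2; have Ld := levR l3.
move: n2 l2 l3 Lc Ld p2 p3 E2 E3; rewrite lb ld.
move: D2 D3; rewrite !inE.
move=> /or4P[/eqP->|/eqP->|/eqP->|/or3P[/eqP->|/eqP->|/eqP->]];
  move=> /or4P[/eqP->|/eqP->|/eqP->|/or3P[/eqP->|/eqP->|/eqP->]] // _ /= l2 l3;
  try (exfalso; lia);
  move=> Lc Ld p2 p3; rewrite !dcolE E1 E4 => -> ->;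
  first [ by left; congr nat_of_ord; rewrite -?natr1 ?Lc ?p2; ring
        | by right; congr nat_of_ord; rewrite -?natr1 ?p3 ?p2; ring].
Qed.

Lemma top_C4 a b c d c1 c2 c3 c4 :
  lev a = m.+1 -> on_ring c -> b <> d ->
  adj a b c1 -> adj b c c2 -> adj c d c3 -> adj d a c4 -> c1 = c3 \/ c2 = c4.
Proof.
move=> la rc bd ab bc cd /adj_sym ad.
have [rb lb E1] := adj_top la ab; have [rd ld E4] := adj_top la ad.
have [d2 D2 [l2 /(_ rc) p2 E2]] := adj_ring rb bc.
have [d3 D3 [l3 /(_ rd) p3 E3]] := adj_ring rc cd.
have n2 : d3 != opp_dir d2.
  apply/eqP => E; apply: bd; apply: vertex_eq; first by rewrite lb ld.
  by move=> _; rewrite p3 p2 E rmorphN /= addrK.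
have lc : (lev c <= m)%N by case/andP: rc.
(* Here the number of rings is tied to their length: the upper pole edge at position [i] has colour
   [i + m + 1 = i - 2]. *)
have mE : m%:R = - 3%:R :> Zk.
  have : (m + 3)%:R = 0 :> Zk by rewrite addn3; exact: natr_Zk0.
  by rewrite natrD => /eqP; rewrite addr_eq0 => /eqP.
have Lc := levR l2; have Ld := levR l3.
move: n2 l2 l3 Lc Ld p2 p3 E2 E3; rewrite lb ld.
move: D2 D3; rewrite !inE.
move=> /or4P[/eqP->|/eqP->|/eqP->|/or3P[/eqP->|/eqP->|/eqP->]];
  move=> /or4P[/eqP->|/eqP->|/eqP->|/or3P[/eqP->|/eqP->|/eqP->]] // _ /= l2 l3;
  try (exfalso; lia);
  move=> Lc Ld p2 p3; rewrite !dcolE E1 E4 => -> ->;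
  first [ by left; congr nat_of_ord; rewrite -?natr1 ?Lc ?mE ?p2; ring
        | by right; congr nat_of_ord; rewrite -?natr1 ?mE ?p3 ?p2; ring].
Qed.

(* The two poles are at distance at least 3, so a 4-cycle meets at most one. *)
Lemma pole_opposite a b c c1 c2 : ~~ on_ring a -> a <> c ->
  adj a b c1 -> adj b c c2 -> on_ring c.
Proof.
move=> ra ac ab /adj_sym cb.
case: (lev_cases a) => la; first by rewrite la in ra.
  case: (lev_cases c) => // lc; first by case: ac; apply: vertex_eq; rewrite ?la ?lc // (negPf ra).
  by have [_ h _] := adj_bottom la ab; have [_ h' _] := adj_top lc cb; lia.
case: (lev_cases c) => // lc; last by case: ac; apply: vertex_eq; rewrite ?la ?lc // (negPf ra).
by have [_ h _] := adj_top la ab; have [_ h' _] := adj_bottom lc cb; lia.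
Qed.

(** If a pole occurs, the cycle is rotated so that it comes first. *)
Lemma no_rainbow_4cycle a b c d c1 c2 c3 c4 : a <> c -> b <> d ->
  adj a b c1 -> adj b c c2 -> adj c d c3 -> adj d a c4 -> c1 = c3 \/ c2 = c4.
Proof.
have pole x y z t e1 e2 e3 e4 : ~~ on_ring x -> x <> z -> y <> t ->
    adj x y e1 -> adj y z e2 -> adj z t e3 -> adj t x e4 -> e1 = e3 \/ e2 = e4.
  move=> rx xz yt xy yz zt tx; have rz := pole_opposite rx xz xy yz.
  case: (lev_cases x) => lx; first by rewrite lx in rx.
    exact: bottom_C4 lx rz yt xy yz zt tx.
  exact: top_C4 lx rz yt xy yz zt tx.
move=> ac bd ab bc cd da.
have [ra|/pole h] := boolP (on_ring a); last exact: h ac bd ab bc cd da.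
have [rb|/pole h] := boolP (on_ring b); last first.
  by have [] := h _ _ _ _ _ _ _ bd (nesym ac) bc cd da ab; [right|left].
have [rc|/pole h] := boolP (on_ring c); last first.
  by have [] := h _ _ _ _ _ _ _ (nesym ac) (nesym bd) cd da ab bc; [left|right].
have [rd|/pole h] := boolP (on_ring d); last first.
  by have [] := h _ _ _ _ _ _ _ (nesym bd) ac da ab bc cd; [right|left].
exact: ring_C4 ra rb rc rd ac bd ab bc cd da.
Qed.

End StackedAntiprisms.

(** * The stacked antiprism as a graph with a rainbow-free colouring *)

Section StackedAntiprismGraph.
Import Order.TTheory GRing.Theory Num.Theory.
Local Open Scope ring_scope.
Variable m : nat.
Hypothesis m2 : (2 <= m)%N.

Local Notation Zk := 'I_m.+3.

Definition edge_of (x : edge_index m) : {set vertex m} := [set src x; tgt x]%SET.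

Lemma src_neq_tgt (x : edge_index m) : src x != tgt x.
Proof.
apply/eqP; case: x => [[] [j i]|[j i]] /= E; have jm := ltn_ord j.
- have := congr1 (@pos m) E; rewrite !pos_vtx; try lia.
  rewrite -[LHS]addr0 => /addrI /(@natr_Zk_inj m 0 1 isT isT); lia.
- by have := congr1 (@lev m) E; rewrite !lev_vtx; lia.
- by have := congr1 (@lev m) E; rewrite !lev_vtx; lia.
Qed.

(** Levels of the ends tell ring edges from the rest. A vertical edge and a diagonal between the
    same levels differ by the shift of position, and a ring edge is not another one reversed because
    [2] is nonzero modulo [m + 3]. *)
Lemma edge_of_inj : injective edge_of.
Proof.
move=> x y /set2_eq.
case: x => [[] [j i]|[j i]]; case: y => [[] [j' i']|[j' i']] /=;
  have jm := ltn_ord j; have jm' := ltn_ord j';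
  move=> -[] [E1 E2]; have L1 := congr1 (@lev m) E1; have L2 := congr1 (@lev m) E2;
  move: L1 L2; rewrite !lev_vtx; try lia; move=> L1 L2; try (exfalso; lia).
- have jj : j = j' by apply: val_inj => /=; lia.
  by have := congr1 (@pos m) E1; rewrite !pos_vtx; try lia; move=> ->; rewrite jj.
- have P1 := congr1 (@pos m) E1; have P2 := congr1 (@pos m) E2.
  move: P1 P2; rewrite !pos_vtx; try lia; move=> -> /esym.
  rewrite -[LHS]addr0 -addrA => /addrI.
  by move/(@natr_Zk_inj m 0 2 isT isT).
- have jj : j = j' by apply: val_inj => /=; lia.
  (* At [j = 0] the source is the lower pole, so the position is read off the target. *)
  have [j0|j0] := posnP j.
    by have := congr1 (@pos m) E2; rewrite !pos_vtx; try lia; move=> ->; rewrite jj.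
  by have := congr1 (@pos m) E1; rewrite !pos_vtx; try lia; move=> ->; rewrite jj.
- have P1 := congr1 (@pos m) E1; have P2 := congr1 (@pos m) E2.
  move: P1 P2; rewrite !pos_vtx; try lia; move=> ->.
  rewrite -[LHS]addr0 => /addrI/eqP; rewrite eq_sym oppr_eq0 => /eqP.
  by move/(@natr_Zk_inj m 1 0 isT isT).
- have P1 := congr1 (@pos m) E1; have P2 := congr1 (@pos m) E2.
  move: P1 P2; rewrite !pos_vtx; try lia; move=> ->.
  rewrite -[RHS]addr0 => /addrI/eqP; rewrite oppr_eq0 => /eqP.
  by move/(@natr_Zk_inj m 1 0 isT isT).
- have jj : j = j' by apply: val_inj => /=; lia.
  by have := congr1 (@pos m) E1; rewrite !pos_vtx; try lia; move=> ->; rewrite jj.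
Qed.

Lemma antiprism_card2 : [forall e in [set edge_of x | x : edge_index m]%SET, #|e| == 2%N].
Proof.
by apply/forall_inP => e /imsetP[x _ ->]; rewrite cards2 src_neq_tgt.
Qed.

Definition antiprism_graph : sgraph (vertex m) := SGraph antiprism_card2.

Lemma antiprism_edgeP e : e \in edges antiprism_graph -> exists x, e = edge_of x.
Proof. by case/imsetP=> x _ ->; exists x. Qed.

Lemma card_antiprism_graph : #|edges antiprism_graph| = (3 * #|{: vertex m}| - 6)%N.
Proof. by rewrite -card_edge_index // (card_imset _ edge_of_inj). Qed.

(** Colours and curves are given on indices; this carries them to edges as vertex sets, with [a] as
    the value elsewhere. *)
Definition of_edge (A : Type) (f : edge_index m -> A) (a : A) (e : {set vertex m}) : A :=
  if [pick x | edge_of x == e] is Some x then f x else a.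

Lemma of_edgeE A f (a : A) x : of_edge f a (edge_of x) = f x.
Proof.
rewrite /of_edge; case: pickP => [y /eqP/edge_of_inj -> //|/(_ x)].
by rewrite eqxx.
Qed.

Lemma edge_of_end (v : vertex m) x : v \in edge_of x ->
  exists2 b, adj v b (ecol x) & edge_of x = [set v; b]%SET.
Proof.
rewrite !inE => /orP[]/eqP->.
  by exists (tgt x) => //; exists x => //; left.
by exists (src x); [exists x => //; right|rewrite finset.setUC].
Qed.

Lemma antiprism_rainbow_free : rainbow_free_colorable C4 antiprism_graph.
Proof.
exists (of_edge (@ecol m) 0%N); split.
  move=> _ _ /antiprism_edgeP[x ->] /antiprism_edgeP[y ->] xy /eqP/set0Pn[v].
  rewrite finset.in_setI !of_edgeE => /andP[/edge_of_end[b vb Ex] /edge_of_end[b' vb' Ey]] E.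
  by apply: xy; rewrite Ex Ey; rewrite E in vb; rewrite (adj_color_inj m2 vb vb').
move=> [phi [phi_inj phi_edge rainbow]].
set c := of_edge _ _ in rainbow.
have inC (i : 'I_4) : [set i; ordS i]%SET \in edges C4 by apply: imset_f.
have phi2 (i : 'I_4) : (phi @: [set i; ordS i])%SET = [set phi i; phi (ordS i)]%SET.
  by rewrite imsetU !imset_set1.
have step (i : 'I_4) : adj (phi i) (phi (ordS i)) (c (phi @: [set i; ordS i])%SET).
  have [x Ex] := antiprism_edgeP (phi_edge _ (inC i)).
  rewrite Ex /c of_edgeE; exists x => //.
  by move: Ex; rewrite phi2 => /set2_eq.
have o4 (i : 'I_4) : ordS (ordS (ordS (ordS i))) = i.
  by apply: val_inj; case: i => [[|[|[|[|]]]]].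
have ne (i : 'I_4) : phi i <> phi (ordS (ordS i)).
  by move/phi_inj/(congr1 val); case: i => [[|[|[|[|]]]]].
have neE (i : 'I_4) : [set i; ordS i]%SET <> [set ordS (ordS i); ordS (ordS (ordS i))]%SET.
  by move/set2_eq => [] [/(congr1 val) + _]; case: i => [[|[|[|[|]]]]].
pose i0 : 'I_4 := ord0; have := step (ordS (ordS (ordS i0))); rewrite o4 => s3.
have [E|E] := no_rainbow_4cycle m2 (ne i0) (ne (ordS i0)) (step i0) (step (ordS i0))
  (step (ordS (ordS i0))) s3.
  by apply: (neE i0); apply: rainbow.
apply: (neE (ordS i0)); apply: rainbow => //; rewrite o4 //.
Qed.

End StackedAntiprismGraph.

(** * Drawing the stacked antiprisms *)

Section Drawing.
Import Order.TTheory GRing.Theory Num.Theory numFieldNormedType.Exports.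
Local Open Scope classical_set_scope.
Local Open Scope ring_scope.
Variable R : realType.

Lemma int_frac (a b : int) (s t : R) : 0 <= s < 1 -> 0 <= t < 1 ->
  a%:~R + s = b%:~R + t -> a = b /\ s = t.
Proof.
move=> /andP[s0 s1] /andP[t0 t1] E.
have h1 : a < b + 1 by rewrite -(ltr_int R) rmorphD /=; lra.
have h2 : b < a + 1 by rewrite -(ltr_int R) rmorphD /=; lra.
have ab : a = b by lia.
by split=> //; move: E; rewrite ab => /addrI.
Qed.

Lemma cos_sin_periodic (x : R) (z : int) :
  cos (x + z%:~R * (pi *+ 2)) = cos x /\ sin (x + z%:~R * (pi *+ 2)) = sin x.
Proof.
have pos_case (n : nat) (y : R) :
    cos (y + n%:R * (pi *+ 2)) = cos y /\ sin (y + n%:R * (pi *+ 2)) = sin y.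
  elim: n => [|n [IHc IHs]]; first by rewrite mul0r addr0.
  by rewrite -natr1 mulrDl mul1r addrA cosD2pi sinD2pi.
case: z => n; first exact: pos_case.
rewrite NegzE rmorphN /= mulNr.
have [c s] := pos_case n.+1 (x - n.+1%:R * (pi *+ 2)).
by rewrite -c -s subrK.
Qed.

Lemma cos_eq1 (x : R) : cos x = 1 -> exists z : int, x = z%:~R * (pi *+ 2).
Proof.
have pi0 := pi_gt0 R; have pi20 : 0 < pi *+ 2 :> R by rewrite mulr2n; lra.
move=> cx; exists (Num.floor (x / (pi *+ 2))).
set z := Num.floor _; set r := x - z%:~R * (pi *+ 2).
have cr : cos r = 1.
  by have [c _] := cos_sin_periodic r z; rewrite -c subrK.
have /andP[] := floor_itv (x / (pi *+ 2)); rewrite -/z rmorphD /=.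
rewrite ler_pdivlMr // ltr_pdivrMr // mulrDl mul1r => h1 h2.
have r0 : 0 <= r by rewrite subr_ge0.
have r2 : r < pi *+ 2 by rewrite ltrBlDl.
suff : r = 0 by move/eqP; rewrite subr_eq0 => /eqP.
have inj y : 0 <= y <= pi -> cos y = 1 -> y = 0.
  by move=> yI cy; apply: cos_inj; rewrite ?in_itv //= ?lexx ?pi_ge0 // cos0.
have [rp|rp] := leP r pi; first by apply: inj => //; rewrite r0.
(* Injectivity of [cos] is available on [[0, pi]], so a remainder beyond [pi] is reflected. *)
have cr' : cos (pi *+ 2 - r) = 1.
  have [c _] := cos_sin_periodic (- r) 1; rewrite mul1r in c.
  by rewrite addrC c cosN.
have /inj/(_ cr') : 0 <= pi *+ 2 - r <= pi.
  by move: r2; rewrite mulr2n => r2; apply/andP; split; lra.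
by lra.
Qed.

(** * Stereographic coordinates *)

Variable m : nat.
Hypothesis m2 : (2 <= m)%N.

(** The factor [2 m + 1] makes [south u = u] exactly at [u = m + 1/2], halfway between the top ring
    and the upper pole. *)
Definition south (u : R) : R := (2 * m%:R + 1) * (m.+1%:R - u).

(** The shift by [1/2] puts the centre of projection midway between two vertical edges. *)
Definition theta (x : R) : R := (x - 2^-1) / m.+3%:R * (pi *+ 2).

Definition den (u x : R) : R :=
  u ^+ 2 + south u ^+ 2 - 2 * u * south u * cos (theta x).

(* Stereographic projection of the sphere with longitude [theta x] and latitude
   given by the ratio u : south u, from the point u = south u, theta x = 0. *)
Definition stereo (u x : R) : R * R :=
  (2 * u * south u * sin (theta x) / den u x, (u ^+ 2 - south u ^+ 2) / den u x).

Lemma south_ge0 u : u <= m.+1%:R -> 0 <= south u.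
Proof. by move=> u1; rewrite mulr_ge0 ?subr_ge0 // addr_ge0 // mulr_ge0. Qed.

Lemma den_ge0 u x : 0 <= u -> u <= m.+1%:R -> 0 <= den u x.
Proof.
move=> u0 /south_ge0 s0.
have -> : den u x = (u - south u) ^+ 2 + 2 * (u * south u) * (1 - cos (theta x)).
  by rewrite /den; ring.
apply: addr_ge0; first exact: sqr_ge0.
apply: mulr_ge0; first by do 2!apply: mulr_ge0 => //.
by rewrite subr_ge0 cos_le1.
Qed.

(** The denominator is [(u - south u)^2 + 2 u (south u) (1 - cos (theta x))], which vanishes only at
    the centre of projection. *)
Lemma den_gt0 u x : 0 <= u -> u <= m.+1%:R ->
  (u = m%:R + 2^-1 -> forall z : int, x - 2^-1 <> z%:~R * m.+3%:R) -> 0 < den u x.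
Proof.
move=> u0 u1 ns; rewrite lt_neqAle den_ge0 // andbT eq_sym; apply/eqP => D0.
have s0 := south_ge0 u1.
have E : den u x = (u - south u) ^+ 2 + 2 * (u * south u) * (1 - cos (theta x)).
  by rewrite /den; ring.
have p1 : 0 <= 2 * (u * south u) * (1 - cos (theta x)).
  by apply: mulr_ge0; [do 2!apply: mulr_ge0 => //|rewrite subr_ge0 cos_le1].
have p2 := sqr_ge0 (u - south u).
have /eqP : (u - south u) ^+ 2 = 0 by lra.
rewrite sqrf_eq0 subr_eq0 => /eqP us.
have uE : u = m%:R + 2^-1.
  have mp : 0 < m%:R + 1 :> R by rewrite ltr_wpDl.
  apply: (mulfI (lt0r_neq0 mp)); move: us; rewrite /south -(natr1 m); lra.
have m0 : 0 <= m%:R :> R by [].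
have /eqP : 2 * (u * south u) * (1 - cos (theta x)) = 0 by lra.
rewrite mulf_eq0 -us -expr2 mulf_eq0 pnatr_eq0 sqrf_eq0 /= gt_eqF; last by lra.
rewrite subr_eq0 /= => /eqP/esym/cos_eq1[z].
have pi0 := pi_gt0 R; have pi20 : pi *+ 2 != 0 :> R by rewrite gt_eqF // mulr2n; lra.
rewrite /theta => /(mulIf pi20) zE; by apply: (ns uE z); rewrite -zE divfK.
Qed.

(** The formula inverting stereographic projection: the norm of the image determines
    [(a^2 + b^2) / D]. *)
Lemma circle_id (a b C S D : R) : D != 0 -> S ^+ 2 = 1 - C ^+ 2 ->
  D = a ^+ 2 + b ^+ 2 - 2 * a * b * C ->
  (2 * a * b * S / D) ^+ 2 + ((a ^+ 2 - b ^+ 2) / D) ^+ 2 + 1 =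
    2 * (a ^+ 2 + b ^+ 2) / D.
Proof.
move=> D0 CS DE.
have num : (2 * a * b * S) ^+ 2 + (a ^+ 2 - b ^+ 2) ^+ 2 + D ^+ 2 =
    2 * (a ^+ 2 + b ^+ 2) * D by rewrite exprMn CS DE; ring.
transitivity (((2 * a * b * S) ^+ 2 + (a ^+ 2 - b ^+ 2) ^+ 2 + D ^+ 2) / D ^+ 2).
  by field.
by rewrite num; field.
Qed.

(** By [circle_id] and the second coordinate the image determines [a^2 / D] and [b^2 / D], hence the
    ratio [a : b] and [u]. Off the poles it then determines [D], the cosine and sine of the
    longitude, and so the longitude up to full turns. *)
Lemma stereo_inj u u' x x' : 0 <= u -> u <= m.+1%:R -> 0 <= u' -> u' <= m.+1%:R ->
  0 < den u x -> 0 < den u' x' -> stereo u x = stereo u' x' ->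
  u = u' /\ (0 < u -> u < m.+1%:R -> exists z : int, x - x' = z%:~R * m.+3%:R).
Proof.
move=> u0 u1 u0' u1' D0 D0' [].
have s0 := south_ge0 u1; have s0' := south_ge0 u1'.
set a := u; set b := south u in s0 *; set C := cos (theta x); set S := sin (theta x).
set D := den u x in D0 *; set a' := u'; set b' := south u' in s0' *.
set C' := cos (theta x'); set S' := sin (theta x'); set D' := den u' x' in D0' *.
move=> EX EZ.
have CS : S ^+ 2 = 1 - C ^+ 2 by rewrite /S /C sin2cos2.
have CS' : S' ^+ 2 = 1 - C' ^+ 2 by rewrite /S' /C' sin2cos2.
have DE : D = a ^+ 2 + b ^+ 2 - 2 * a * b * C by [].
have DE' : D' = a' ^+ 2 + b' ^+ 2 - 2 * a' * b' * C' by [].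
have nz : D != 0 by rewrite gt_eqF.
have nz' : D' != 0 by rewrite gt_eqF.
have sumE : (2 * a * b * S / D) ^+ 2 + ((a ^+ 2 - b ^+ 2) / D) ^+ 2 + 1 =
    2 * (a ^+ 2 + b ^+ 2) / D.
  exact: circle_id nz CS DE.
have sumE' : (2 * a' * b' * S' / D') ^+ 2 + ((a' ^+ 2 - b' ^+ 2) / D') ^+ 2 + 1 =
    2 * (a' ^+ 2 + b' ^+ 2) / D'.
  exact: circle_id nz' CS' DE'.
have Eq : (a ^+ 2 + b ^+ 2) / D = (a' ^+ 2 + b' ^+ 2) / D'.
  by move: sumE sumE'; rewrite EX EZ -!mulrA; lra.
have Ea : a ^+ 2 / D = a' ^+ 2 / D' by move: Eq EZ; rewrite !mulrBl !mulrDl; lra.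
have Eb : b ^+ 2 / D = b' ^+ 2 / D' by move: Eq EZ; rewrite !mulrBl !mulrDl; lra.
have Eab : (a * b') ^+ 2 = (a' * b) ^+ 2.
  apply: (mulIf (invr_neq0 (mulf_neq0 nz nz'))).
  have -> : (a * b') ^+ 2 / (D * D') = (a ^+ 2 / D) * (b' ^+ 2 / D') by field; rewrite nz nz'.
  by rewrite Ea -Eb; field; rewrite nz nz'.
have uu : u = u'.
  have p1 : 0 <= a * b' by exact: mulr_ge0.
  have p2 : 0 <= a' * b by exact: mulr_ge0.
  have /eqP := Eab; rewrite eqrXn2 // => /eqP; rewrite /b /b' /south /a /a' => E.
  have mp : 0 < (2 * m%:R + 1) * m.+1%:R :> R by rewrite mulr_gt0 // ltr_wpDl // mulr_ge0.
  by apply: (mulIf (lt0r_neq0 mp)); move: E; lra.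
split=> // ap bp.
have bb : b' = b by rewrite /b /b' uu.
have aa : a' = a by rewrite /a /a' uu.
have b0 : 0 < b by rewrite mulr_gt0 ?subr_gt0 // ltr_wpDl // mulr_ge0.
rewrite aa bb in Eq EX DE'.
have q0 : 0 < a ^+ 2 + b ^+ 2 by apply: addr_gt0; exact: exprn_gt0.
have DD : D = D' by move: Eq => /(mulfI (lt0r_neq0 q0))/invr_inj.
have ab0 : 2 * a * b != 0 by rewrite gt_eqF //; do 2!apply: mulr_gt0 => //.
have CC : C = C' by apply: (mulfI ab0); move: DD; rewrite DE DE'; lra.
have SS : S = S'.
  by apply: (mulfI ab0); apply: (mulIf (invr_neq0 nz)); rewrite EX DD.
have /cos_eq1[z] : cos (theta x - theta x') = 1.
  by rewrite cosB -/C -/C' -/S -/S' -CC -SS -!expr2 CS; ring.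
have pi0 := pi_gt0 R; have pi20 : pi *+ 2 != 0 :> R by rewrite gt_eqF // mulr2n; lra.
rewrite /theta -mulrBl => /(mulIf pi20) zE; exists z.
apply: (mulIf (invr_neq0 (_ : m.+3%:R != 0 :> R))); first by rewrite pnatr_eq0.
by rewrite mulfK ?pnatr_eq0 // -zE; ring.
Qed.

Lemma stereo_periodic u x x' (z : int) : x = x' + z%:~R * m.+3%:R ->
  stereo u x = stereo u x'.
Proof.
move=> xE; have tE : theta x = theta x' + z%:~R * (pi *+ 2).
  rewrite /theta xE; field; rewrite ?pnatr_eq0 //.
by have [c s] := cos_sin_periodic (theta x') z; rewrite /stereo /den tE c s.
Qed.

Lemma stereo_pole u x x' : u = 0 \/ u = m.+1%:R -> stereo u x = stereo u x'.
Proof. by case=> ->; rewrite /stereo /den /south ?subrr ?(mulr0, mul0r). Qed.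

End Drawing.

(** * The edges of the antiprism as arcs in the plane *)

Section PlanarDrawing.
Import Order.TTheory GRing.Theory Num.Theory numFieldNormedType.Exports.
Local Open Scope classical_set_scope.
Local Open Scope ring_scope.
Variables (R : realType) (m : nat).
Hypothesis m2 : (2 <= m)%N.

Local Notation Zk := 'I_m.+3.

(** In height and [longitude] every edge is a straight segment. Longitudes are left unreduced modulo
    [m + 3], so that edges across the seam stay continuous. *)
Definition height (x : edge_index m) (t : R) : R :=
  match x with
  | inl (inl (j, _)) => j.+1%:R
  | inl (inr (j, _)) => (nat_of_ord j)%:R + t
  | inr (j, _) => j.+1%:R + t
  end.

Definition longitude (x : edge_index m) (t : R) : R :=
  match x with
  | inl (inl (_, i)) => (nat_of_ord i)%:R + t
  | inl (inr (_, i)) => (nat_of_ord i)%:R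
  | inr (_, i) => (nat_of_ord i)%:R - t
  end.

Definition curve (x : edge_index m) (t : R) : R * R :=
  stereo m (height x t) (longitude x t).

Definition place (v : vertex m) : R * R := stereo m (lev v)%:R (nat_of_ord (pos v))%:R.

Lemma height_bounds x t : 0 <= t <= 1 -> 0 <= height x t /\ height x t <= m.+1%:R.
Proof.
move=> /andP[t0 t1]; case: x => [[] [j i]|[j i]] /=; have jm := ltn_ord j.
- by rewrite ler_nat; split=> //; lia.
- have : (nat_of_ord j)%:R <= m%:R :> R by rewrite ler_nat; lia.
  have : 0 <= (nat_of_ord j)%:R :> R by [].
  by rewrite -(natr1 m); split; lra.
- have : j.+2%:R <= m%:R :> R by rewrite ler_nat; lia.
  have : 0 <= j%:R :> R by [].
  by rewrite -(natr1 m) -(natr1 j.+1) -(natr1 j); split; lra.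
Qed.

Lemma half_int (a b : int) : a%:~R - 2^-1 <> b%:~R :> R.
Proof.
move=> E; have [_ h] : a = b /\ 0 = 2^-1 :> R.
  by apply: int_frac; rewrite ?lexx //=; lra.
by lra.
Qed.

(** No edge meets the centre of projection: ring edges and diagonals never have height [m + 1/2],
    and vertical edges have integral longitude. *)
Lemma curve_den x t : 0 <= t <= 1 -> 0 < den m (height x t) (longitude x t).
Proof.
move=> tI; have [h0 h1] := height_bounds x tI; apply: den_gt0 => // {h0 h1}.
move/andP: tI => [t0 t1]; case: x => [[] [j i]|[j i]] /=; have jm := ltn_ord j.
- move=> E; exfalso; apply: (@half_int j.+1%:Z m%:Z).
  by rewrite -!pmulrn E; lra.
- by move=> _ z E; apply: (@half_int (nat_of_ord i)%:Z (z * m.+3%:Z)); rewrite rmorphM /=.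
- move=> E; exfalso; have : j.+2%:R <= m%:R :> R by rewrite ler_nat; lia.
  by move: E; rewrite -(natr1 j.+1); lra.
Qed.

Lemma place_den (v : vertex m) : 0 < den m (lev v)%:R ((nat_of_ord (pos v))%:R : R).
Proof.
apply: den_gt0 => //; first by rewrite ler_nat lev_le.
move=> E; exfalso; apply: (@half_int (lev v)%:Z m%:Z).
by rewrite -!pmulrn E; lra.
Qed.

Lemma lev_bounds (v : vertex m) : 0 <= (lev v)%:R :> R /\ (lev v)%:R <= m.+1%:R :> R.
Proof. by rewrite ler_nat lev_le. Qed.

Lemma longitude_eq (i i' : Zk) (z : int) (s t : R) : 0 <= s < 1 -> 0 <= t < 1 ->
  (nat_of_ord i)%:R + s - ((nat_of_ord i')%:R + t) = z%:~R * m.+3%:R ->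
  i = i' /\ s = t.
Proof.
move=> sI tI E.
have [|h ->] := @int_frac R (nat_of_ord i)%:Z ((nat_of_ord i')%:Z + z * m.+3%:Z) s t sI tI.
  by rewrite rmorphD rmorphM /= -!pmulrn; lra.
split=> //; apply: val_inj => /=.
have im := ltn_ord i; have im' := ltn_ord i'.
(* Both positions lie between [0] and [m + 2], so they cannot differ by a nonzero multiple of
   [m + 3]. *)
have z0 : z = 0 by nia.
by move: h; rewrite z0; lia.
Qed.

Lemma place_inj : injective place.
Proof.
move=> u v E; have [a0 a1] := lev_bounds u; have [b0 b1] := lev_bounds v.
have [/eqP] := stereo_inj a0 a1 b0 b1 (place_den u) (place_den v) E.
rewrite eqr_nat => /eqP l h; apply: vertex_eq => // /andP[l0 lm].
have [||z zE] := h; [by rewrite ltr0n|by rewrite ltr_nat|].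
have := @longitude_eq (pos u) (pos v) z 0 0; rewrite !addr0 lexx ltr01.
by move=> /(_ isT isT zE)[].
Qed.

Lemma place_vtx l (i : Zk) : (l <= m.+1)%N -> place (vtx l i) = stereo m l%:R (nat_of_ord i)%:R.
Proof.
move=> lm; rewrite /place lev_vtx //; have [l0|l0] := posnP l.
  by rewrite l0; apply: stereo_pole; left.
have [lm'|lm'] := leqP l m; first by rewrite pos_vtx // l0.
by apply: stereo_pole; right; congr (_%:R); lia.
Qed.

Lemma succ_longitude (i : Zk) : exists z : int,
  (nat_of_ord i)%:R + 1 = (nat_of_ord (i + 1))%:R + z%:~R * m.+3%:R :> R.
Proof.
exists (i.+1 %/ m.+3)%N%:Z; rewrite -pmulrn natr1 -natrM -natrD.
congr (_%:R); have -> : nat_of_ord (i + 1) = (i.+1 %% m.+3)%N.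
  by change ((i + 1 %% m.+3) %% m.+3 = i.+1 %% m.+3)%N; rewrite modnDmr addn1.
by rewrite addnC -divn_eq.
Qed.

Lemma curve_src x : curve x 0 = place (src x).
Proof.
rewrite /curve; case: x => [[] [j i]|[j i]]; rewrite /src place_vtx;
  try (by have := ltn_ord j; lia).
- by rewrite /height /longitude addr0.
- by rewrite /height /longitude addr0.
- by rewrite /height /longitude addr0 subr0.
Qed.

Lemma curve_tgt x : curve x 1 = place (tgt x).
Proof.
rewrite /curve; case: x => [[] [j i]|[j i]]; rewrite /tgt place_vtx;
  try (by have := ltn_ord j; lia); rewrite /height /longitude.
- by have [z zE] := succ_longitude i; apply: stereo_periodic zE.
- by rewrite natr1.
- rewrite natr1; have [z zE] := succ_longitude (i - 1); rewrite subrK in zE.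
  by apply: (@stereo_periodic R m _ _ _ (- z)); rewrite rmorphN /=; lra.
Qed.

Lemma curve_eq x y s t : 0 <= s <= 1 -> 0 <= t <= 1 -> curve x s = curve y t ->
  height x s = height y t /\ (0 < height x s -> height x s < m.+1%:R ->
    exists z : int, longitude x s - longitude y t = z%:~R * m.+3%:R).
Proof.
move=> sI tI E; have [a0 a1] := height_bounds x sI; have [b0 b1] := height_bounds y tI.
exact: stereo_inj a0 a1 b0 b1 (curve_den x sI) (curve_den y tI) E.
Qed.

(** Inside an edge the height or the longitude is not an integer, while at a vertex both are. *)
Lemma curve_place x v t : 0 < t < 1 -> curve x t <> place v.
Proof.
move=> tI E; have tI' : 0 <= t <= 1 by move/andP: tI => []; lra.
have t01 : 0 <= t < 1 by move/andP: tI => []; lra.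
have o01 : 0 <= (0 : R) < 1 by rewrite lexx ltr01.
have [a0 a1] := height_bounds x tI'; have [b0 b1] := lev_bounds v.
have [hE h] := stereo_inj a0 a1 b0 b1 (curve_den x tI') (place_den v) E.
have t0 : t <> 0 by move/andP: tI => []; lra.
case: x hE h {E a0 a1} => [[] [j i]|[j i]] /= hE h.
- have jm := ltn_ord j; have [||z zE] := h; [by rewrite ltr0n|by rewrite ltr_nat; lia|].
  have [] := @longitude_eq i (pos v) z t 0 t01 o01 _; last by [].
  by rewrite addr0.
- have [] := @int_frac R (nat_of_ord j)%:Z (lev v)%:Z t 0 t01 o01; last by [].
  by rewrite addr0.
- have [] := @int_frac R j.+1%:Z (lev v)%:Z t 0 t01 o01; last by [].
  by rewrite addr0.
Qed.

Lemma curve_inj x s t : 0 <= s <= 1 -> 0 <= t <= 1 -> curve x s = curve x t -> s = t.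
Proof.
move=> sI tI E; have [hE h] := curve_eq sI tI E.
case: x hE h {E} => [[] [j i]|[j i]] /= hE h.
- have jm := ltn_ord j; have [||z zE] := h; [by rewrite ltr0n|by rewrite ltr_nat; lia|].
  (* On a ring edge [s - t] is a multiple of [m + 3] and at most 1 in absolute value, hence zero. *)
  have zk : s - t = (z * m.+3%:Z)%:~R by rewrite rmorphM /= -pmulrn -zE; lra.
  have h1 : (z * m.+3%:Z) < 2.
    by rewrite -(ltr_int R) -zk; move/andP: sI => []; move/andP: tI => []; lra.
  have h2 : -2 < (z * m.+3%:Z).
    by rewrite -(ltr_int R) -zk; move/andP: sI => []; move/andP: tI => []; lra.
  have z0 : z = 0 by nia.
  by move: zk; rewrite z0 mul0r; lra.
- by lra.
- by lra.
Qed.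

Lemma height_interior (x : edge_index m) (t : R) : 0 < t < 1 ->
  0 < height x t /\ height x t < m.+1%:R.
Proof.
move=> /andP[t0 t1]; case: x => [[] [j i]|[j i]] /=; have jm := ltn_ord j.
- by rewrite ltr0n ltr_nat.
- have : (nat_of_ord j)%:R <= m%:R :> R by rewrite ler_nat -ltnS.
  have : 0 <= (nat_of_ord j)%:R :> R by [].
  by rewrite -(natr1 m); split; lra.
- have : j.+2%:R <= m%:R :> R by rewrite ler_nat; lia.
  have : 0 <= j%:R :> R by [].
  by rewrite -(natr1 m) -(natr1 j.+1) -(natr1 j); split; lra.
Qed.

(** Fractional parts reveal the family: inside a ring edge only the longitude is fractional, inside
    a vertical edge only the height, inside a diagonal both. The integral parts then identify the
    edge. *)
Lemma curve_disjoint x y s t : 0 < s < 1 -> 0 < t < 1 -> curve x s = curve y t -> x = y.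
Proof.
move=> sI tI E.
have sI' : 0 <= s <= 1 by move/andP: sI => []; lra.
have tI' : 0 <= t <= 1 by move/andP: tI => []; lra.
have s01 : 0 <= s < 1 by move/andP: sI => []; lra.
have t01 : 0 <= t < 1 by move/andP: tI => []; lra.
have o01 : 0 <= (0 : R) < 1 by rewrite lexx ltr01.
have s0 : s <> 0 by move/andP: sI => []; lra.
have t0 : t <> 0 by move/andP: tI => []; lra.
have [hE h] := curve_eq sI' tI' E.
have frac (a b : nat) (u v : R) : 0 <= u < 1 -> 0 <= v < 1 -> a%:R + u = b%:R + v ->
    a = b /\ u = v.
  by move=> uI vI /(@int_frac R a b u v uI vI) [[]].
have [h1 h2] := height_interior x sI; have [z zE] := h h1 h2.
case: x hE zE {E h h1 h2} => [[] [j i]|[j i]];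
  case: y => [[] [j' i']|[j' i']] /= hE zE.
- have [-> _] := longitude_eq s01 t01 zE.
  have /eqP := hE; rewrite eqr_nat => /eqP [jj].
  by congr (inl (inl (_, _))); apply: val_inj.
- by have [] := frac j.+1 j' 0 t o01 t01 ltac:(lra) => _ /esym.
- by have [] := frac j.+1 j'.+1 0 t o01 t01 ltac:(lra) => _ /esym.
- by have [] := frac j j'.+1 s 0 s01 o01 ltac:(lra).
- have [jj _] := frac _ _ _ _ s01 t01 hE.
  have [-> _] := @longitude_eq i i' z 0 0 o01 o01 ltac:(lra).
  by congr (inl (inr (_, _))); apply: val_inj.
- have [_ st] := frac _ _ _ _ s01 t01 hE.
  by have [_ t00] := @longitude_eq i i' z t 0 t01 o01 ltac:(lra).
- by have [] := frac j.+1 j'.+1 s 0 s01 o01 ltac:(lra).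
- have [_ st] := frac _ _ _ _ s01 t01 hE.
  by have [_ /esym] := @longitude_eq i i' z 0 t o01 t01 ltac:(lra).
- have [jj st] := frac _ _ _ _ s01 t01 hE.
  have [-> _] := @longitude_eq i i' z 0 0 o01 o01 ltac:(lra).
  by congr (inr (_, _)); apply: val_inj; case: jj.
Qed.

Lemma curve_continuous x : {within `[0, 1], continuous (curve x)}.
Proof.
apply: continuous_in_subspaceT => t; rewrite inE /= in_itv /= => tI.
have d0 : den m (height x t) (longitude x t) != 0 by rewrite gt_eqF ?curve_den.
have ch : {for t, continuous (height x)}.
  by case: x {d0} => [[] [j i]|[j i]]; rewrite /height;
    [exact: cvg_cst|apply: cvgD; [exact: cvg_cst|exact: cvg_id]..].
have cl : {for t, continuous (longitude x)}.
  by case: x {d0 ch} => [[] [j i]|[j i]]; rewrite /longitude;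
    [apply: cvgD; [exact: cvg_cst|exact: cvg_id]|exact: cvg_cst
    |apply: cvgB; [exact: cvg_cst|exact: cvg_id]].
have cs : {for t, continuous (fun s => south m (height x s))}.
  by apply: cvgM; [exact: cvg_cst|apply: cvgB; [exact: cvg_cst|exact: ch]].
have ct : {for t, continuous (fun s => theta m (longitude x s))}.
  apply: cvgM; last exact: cvg_cst.
  by apply: cvgM; last exact: cvg_cst; apply: cvgB; [exact: cl|exact: cvg_cst].
have cc : {for t, continuous (fun s => cos (theta m (longitude x s)))}.
  by apply: (continuous_comp ct); exact: continuous_cos.
have csn : {for t, continuous (fun s => sin (theta m (longitude x s)))}.
  by apply: (continuous_comp ct); exact: continuous_sin.
have cp : {for t, continuous (fun s => 2 * height x s * south m (height x s))}.
  by apply: cvgM => //; apply: cvgM; [exact: cvg_cst|exact: ch].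
have cd : {for t, continuous (fun s => den m (height x s) (longitude x s))}.
  apply: cvgB; last exact: cvgM.
  by apply: cvgD; [exact: cvgM|exact: cvgM].
have cdV : {for t, continuous (fun s => (den m (height x s) (longitude x s))^-1)}.
  exact: cvgV.
have c1 : {for t, continuous (fun s => (curve x s).1)}.
  by apply: cvgM => //; apply: cvgM.
have c2 : {for t, continuous (fun s => (curve x s).2)}.
  by apply: cvgM => //; apply: cvgB; exact: cvgM.
exact: cvg_pair c1 c2.
Qed.

Lemma antiprism_planar : planar R (antiprism_graph m2).
Proof.
exists place, (of_edge (@curve) (fun=> 0)); split.
- exact: place_inj.
- move=> _ /antiprism_edgeP[x ->]; rewrite of_edgeE //; split; first exact: curve_continuous.
  by move=> s t; rewrite !in_itv /=; apply: curve_inj.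
- move=> _ /antiprism_edgeP[x ->]; exists (src x), (tgt x).
  by rewrite of_edgeE // curve_src curve_tgt.
- move=> _ t v /antiprism_edgeP[x ->]; rewrite of_edgeE // in_itv /=; apply: curve_place.
- move=> _ _ s t /antiprism_edgeP[x ->] /antiprism_edgeP[y ->] xy.
  rewrite !of_edgeE // !in_itv /= => sI tI /(curve_disjoint sI tI) E.
  by apply: xy; rewrite E.
Qed.

End PlanarDrawing.

(** * Transport along a bijection of the vertices *)

Section Transport.
Variables (V W : finType) (f : V -> W) (g : W -> V) (G : sgraph V).
Hypotheses (fK : cancel f g) (gK : cancel g f).

Let g_inj : injective g := can_inj gK.

Lemma imset_gK (e : {set W}) : f @: (g @: e) = e.
Proof. by rewrite -imset_comp (eq_imset _ gK) imset_id. Qed.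

Lemma imset_fK (e : {set V}) : g @: (f @: e) = e.
Proof. by rewrite -imset_comp (eq_imset _ fK) imset_id. Qed.

Lemma transport_card2 : [forall e in [set e : {set W} | g @: e \in edges G], #|e| == 2].
Proof.
apply/forall_inP => e; rewrite inE => eG.
by have /forall_inP/(_ _ eG) := edges_card2 G; rewrite card_imset.
Qed.

Definition transport : sgraph W := SGraph transport_card2.

Lemma in_transport e : (e \in edges transport) = (g @: e \in edges G).
Proof. by rewrite inE. Qed.

Lemma card_transport : #|edges G| <= #|edges transport|.
Proof.
rewrite -(card_imset _ (imset_inj (can_inj fK))); apply/subset_leq_card/fintype.subsetP.
by move=> _ /imsetP[e eG ->]; rewrite in_transport imset_fK.
Qed.

Lemma planar_transport (R : realType) : planar R G -> planar R transport.
Proof.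
move=> [pt [arc [pinj carc ends inner cross]]].
exists (pt \o g), (fun e : {set W} => arc (g @: e)); split.
- exact: inj_comp.
- by move=> e; rewrite in_transport => /carc.
- move=> e; rewrite in_transport => /ends[x [y [E a0 a1]]]; exists (f x), (f y).
  rewrite /= !fK; split=> //; rewrite -[LHS]imset_gK E.
  by rewrite imsetU !imset_set1.
- by move=> e t v; rewrite in_transport => eG tI; apply: inner.
- move=> e e' s t; rewrite !in_transport => eG e'G ee' sI tI; apply: cross => //.
  by move=> /imset_inj - /(_ g_inj).
Qed.

Lemma rainbow_free_transport (U : finType) (H : sgraph U) :
  rainbow_free_colorable H G -> rainbow_free_colorable H transport.
Proof.
move=> [c [cP no]]; exists (fun e : {set W} => c (g @: e)); split.
  move=> e e'; rewrite !in_transport => eG e'G ee' /eqP/set0Pn[v].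
  rewrite finset.in_setI => /andP[ve ve']; apply: cP => //.
    by move=> /imset_inj - /(_ g_inj).
  by apply/eqP/set0Pn; exists (g v); rewrite finset.in_setI !imset_f.
move=> [phi [pinj pE pc]]; apply: no; exists (g \o phi); split.
- exact: inj_comp.
- by move=> e /pE; rewrite in_transport -imset_comp.
- move=> e e' eH e'H /=; rewrite (imset_comp g phi e) (imset_comp g phi e').
  exact: pc.
Qed.

End Transport.

(** * The two bounds combined *)

Theorem theorem1 (R : realType) (k n : nat) (hk : 5 <= k)
    (hn : n = k ^ 2 - 3 * k + 2) :
  rainbow_planar_turan R n C4 = 3 * n - 6.
Proof.
have m2 : 2 <= k - 3 by lia.
have nE : #|{: vertex (k - 3)}| = n by rewrite card_vertex; nia.
have n3 : 3 <= n by nia.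
apply/eqP; rewrite eqn_leq; apply/andP; split.
  by apply/bigmax_leqP => G /asboolP[pG _]; exact: planar_card pG.
(* The maximum ranges over graphs on ['I_n], so the antiprism with [k - 3] rings is relabelled by an
   enumeration of its [k (k - 3) + 2 = n] vertices. *)
pose f (v : vertex (k - 3)) := cast_ord nE (enum_rank v).
pose g (i : 'I_n) := enum_val (cast_ord (esym nE) i) : vertex (k - 3).
have fK : cancel f g by move=> v; rewrite /f /g cast_ordK enum_rankK.
have gK : cancel g f by move=> i; rewrite /f /g enum_valK cast_ordKV.
pose G := transport (antiprism_graph m2) gK.
apply: (@leq_trans #|edges G|).
  have <- : #|edges (antiprism_graph m2)| = 3 * n - 6.
    by rewrite card_antiprism_graph nE.
  exact: card_transport.
apply: (leq_bigmax_cond (F := fun G : sgraph 'I_n => #|edges G|)).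
apply/asboolP; split.
  exact/planar_transport/antiprism_planar.
exact/rainbow_free_transport/antiprism_rainbow_free.
Qed.
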